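(* Let $V$ be a variety in $\mathbb{F}_q^d$, $d\ge2$, with $n=\dim(V)\ge1$, $D=\deg(V)$, and $t=t(V)=q^{\ell}$, and let $\gamma(n)=\frac{1}{2^{n+1}-n-2}$. For all sufficiently large $q$ and every $E\subseteq V$ with $|E|=q^{\alpha}$ and $$\alpha\ge\min\left\{\frac{d+2+\gamma(n)\ell}{2+\gamma(n)},\ \frac{d+4+2\gamma(n)\ell}{2+2\gamma(n)}\right\},$$ we have $|\Delta(E)|\gg q$.
   Context: $\mathbb{F}_q$ is a finite field of odd order $q$; for $\mathbf{x}\in\mathbb{F}_q^d$, $\|\mathbf{x}\|=x_1^2+\cdots+x_d^2$; $\Delta(E)=\{\|\mathbf{x}-\mathbf{y}\|:\mathbf{x},\mathbf{y}\in E\}$. For a variety $V\subseteq\mathbb{F}_q^d$, its dimension is $\dim(V)=\max\{m:\ V\supseteq X_m\supseteq X_{m-1}\supseteq\cdots\supseteq X_0\ne\varnothing\}$, where each $X_j$ is an irreducible subvariety of $V$ (a strictly decreasing chain, as usual). If $V$ is irreducible with $\dim(V)=n$, its degree is $\deg(V)=\sup\{|L\cap V|<\infty:\ L\subset\mathbb{F}_q^d\text{ is a }(d-n)\text{-dimensional affine subspace}\}$. The coset content of $V$ is $t(V)=\max\{|\Gamma|:\ x\in\mathbb{F}_q^d,\ \Gamma\le\mathbb{F}_q^d\text{ a subgroup},\ x+\Gamma\subseteq V\}$. The notation $X\gg Y$ means $X\ge cY$ for a constant $c>0$ not depending on $q$ or $E$. The constant $c$, and how large $q$ must be, may depend on $d$,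 $n$ and $D$. *)

(* Defs.v *)
From mathcomp Require Import all_boot all_order all_algebra all_fingroup.
From mathcomp Require Import mpoly.
From mathcomp Require Import boolp classical_sets cardinality reals exp.

Set Implicit Arguments.
Unset Strict Implicit.
Unset Printing Implicit Defensive.

Import Order.TTheory GRing.Theory Num.Theory.

Local Open Scope classical_set_scope.
Local Open Scope ring_scope.

(* Over the finite set F^d every subset is algebraic and every irreducible    *)
(* set is a point, so dimension and degree carry no information there.  As    *)
(* usual, a variety "in F^d" is therefore cut out by polynomials over F, but  *)
(* its geometry is that of its points over an algebraic closure               *)
(* iota : F -> K; its F-rational points are used for E and for t(V).          *)

Section Varieties.

Variables (F : finFieldType) (K : closedFieldType) (iota : {rmorphism F -> K}).
Variable d : nat.

Definition zero_locus (s : seq {mpoly F[d]}) : set 'rV[K]_d :=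
  [set x | forall f, f \in s -> (map_mpoly iota f).@[fun i => x 0 i] = 0].

Definition variety (V : set 'rV[K]_d) : Prop := exists s, V = zero_locus s.

(* Subvarieties, like varieties, are defined over F, so irreducibility is     *)
(* irreducibility over F; it is implied by geometric irreducibility.          *)
Definition irreducible_variety (V : set 'rV[K]_d) : Prop :=
  [/\ variety V, V !=set0 &
      forall Y Z, variety Y -> variety Z -> V = Y `|` Z -> V = Y \/ V = Z].

Definition has_chain (V : set 'rV[K]_d) (m : nat) : Prop :=
  exists X : nat -> set 'rV[K]_d,
    (forall j, (j <= m)%N -> irreducible_variety (X j) /\ X j `<=` V) /\
    (forall j, (j < m)%N -> X j `<` X j.+1).

Definition is_dim (V : set 'rV[K]_d) (n : nat) : Prop :=
  has_chain V n /\ forall m, has_chain V m -> (m <= n)%N.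

Definition affine_subspace (k : nat) (L : set 'rV[K]_d) : Prop :=
  exists (a : 'rV[K]_d) (W : {vspace 'rV[K]_d}),
    \dim W = k /\ L = [set x | x - a \in W].

(* The equation k + n = d avoids truncated subtraction in the codimension.    *)
Definition finite_section_sizes (V : set 'rV[K]_d) (n : nat) : set nat :=
  [set m | exists k L,
     [/\ (k + n = d)%N, affine_subspace k L & (L `&` V #= `I_m)%card]].

(* The degree of an irreducible V of dimension n.                             *)
Definition is_degree (V : set 'rV[K]_d) (n D : nat) : Prop :=
  isLub (finite_section_sizes V n) D.

Definition rational_points (V : set 'rV[K]_d) : {set 'rV[F]_d} :=
  finset (fun x : 'rV[F]_d => `[< V (map_mx iota x) >]).

(* A finite zmodType is a finGroupType under addition, so {group 'rV[F]_d} is *)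
(* the type of additive subgroups of F^d.                                     *)
Definition coset_content (V : set 'rV[K]_d) : nat :=
  \max_(a : 'rV[F]_d)
    \max_(G : {group 'rV[F]_d} |
          [set (a + g)%R | g in G]%SET \subset rational_points V) #|G|.

End Varieties.

Definition sqnorm (F : finFieldType) (d : nat) (x : 'rV[F]_d) : F :=
  \sum_(i < d) x 0 i ^+ 2.

Definition distance_set (F : finFieldType) (d : nat) (E : {set 'rV[F]_d})
    : {set F} :=
  [set sqnorm (x - y) | x in E, y in E]%SET.

Definition gamma (R : realType) (n : nat) : R :=
  (2%:R ^+ n.+1 - n%:R - 2%:R)^-1.

(* Main.v *)
(* As 1/gamma(n) = 2^(n+1) - n - 2 >= n and ell >= 0, each of the thresholds  *)
(* is at least (d+1)/2 or at least n + 1/4.                                   *)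
(*                                                                            *)
(* In the first case |E|^2 >= q^(d+1), and a second moment computation for    *)
(* point-hyperplane incidences bounds the number of quadruples of E with      *)
(* ||x - y|| = ||x' - y'|| by 2|E|^4/q; Cauchy-Schwarz gives |Delta(E)| >=    *)
(* q/2, for an arbitrary set E.                                               *)
(*                                                                            *)
(* The second case is impossible for large q, since |V(F_q)| <= D q^n as soon *)
(* as q > (D+1)d.  To see this, cut V by F_q-rational hyperplanes             *)
(* sum_i t^i x_i = a, choosing t so that the form is constant on no top       *)
(* dimensional component.  There are at most D such components, because a     *)
(* generic linear section over K is finite and meets each of them in a        *)
(* different point.  The latter rests on the fact that a generic hyperplane   *)
(* section of an irreducible set of dimension m + 1 has dimension at least m. *)
(* This follows from the extension of specializations, applied to m + 1       *)
(* algebraically independent functions that a chain of irreducible sets       *)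
(* provides.                                                                  *)

From HB Require Import structures.
Require Import Defs.
From mathcomp Require Import all_boot all_order all_algebra all_fingroup all_field.
From mathcomp Require Import ring lra zify.
From mathcomp Require Import mpoly.
From mathcomp Require Import boolp classical_sets cardinality reals exp.

Set Implicit Arguments.
Unset Strict Implicit.
Unset Printing Implicit Defensive.

Import Order.TTheory GRing.Theory Num.Theory.

Local Open Scope ring_scope.

(** * Hilbert's basis theorem *)

(** Put [g = 2^(n+1) - n - 2], the inverse of [gamma R n]. Then [g >= n], and [ell >= 0] since the
    coset content is a positive integer. By [first_threshold] and [second_threshold], either
    [alpha >= (d+1)/2], or [n <= d] and [alpha >= n + 1/4].

    In the first case [card_distance_set] reads each equality [||x - y|| = ||x' - y'||] in [E] as an
    incidence in [F^(2d+1)] between a point given by [(x, x')] and a hyperplane given by [(y, y')].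
    The variance estimate [incidence_bound] allows at most twice the expected number [|E|^4 / q] of
    them, and Cauchy-Schwarz yields [q/2] distances. In the second case [card_rational_points] gives
    [q^(n+1/4) <= |E| <= D q^n], so [q <= D^4], which large [q] excludes.

    The bound on rational points is the main work. Slicing by [q] parallel hyperplanes over [F]
    lowers the dimension if no top-dimensional component lies in a slice; such a direction exists
    because there are at most [D] components. That count is [finite_section]: generic cuts over [K]
    end in a finite section with a separate point for each component. A generic cut loses only one
    dimension ([zheight_slice]): a chain of length [m+1] provides [m+1] algebraically independent
    functions, their values fill a nonempty open set ([alg_indep_lift]), and fixing the value of one
    leaves the others independent on some component of the slice. These chains live over [K],
    whereas [is_dim] speaks of chains over [F]; [rational_closure_proper] compares the two through
    Frobenius orbits. *)

Lemma mmulti_muni (n : nat) (R : comNzRingType) (p : {mpoly R[n.+1]}) :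
  (map_poly (@mwiden n R) (muni p)).['X_ord_max] = p.
Proof.
rewrite muniE [RHS]mpolyE !rmorph_sum /= horner_sum; apply: eq_bigr => m _.
rewrite -mul_polyC rmorphM /= map_polyC map_polyXn hornerM hornerC hornerXn /=.
rewrite mwidenZ -scalerAl mwidenX; congr (_ *: _).
rewrite [RHS]mpolyXE_id big_ord_recr /= mpolyXE_id; congr (_ * _).
rewrite big_ord_recr /= mnmwiden_ordmax expr0 mulr1; apply: eq_bigr => i _.
by rewrite mnmwiden_widen mnmE.
Qed.

Lemma muni_eq0 (n : nat) (R : comNzRingType) (p : {mpoly R[n.+1]}) :
  (muni p == 0) = (p == 0).
Proof.
apply/eqP/eqP => [p0|->]; last exact: raddf0.
by rewrite -[p]mmulti_muni p0 raddf0 horner0.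
Qed.

Lemma meval_muni (n : nat) (R : comNzRingType) (p : {mpoly R[n.+1]})
    (v : 'I_n.+1 -> R) (w : 'I_n -> R) :
  (forall i, w i = v (widen_ord (leqnSn n) i)) ->
  p.@[v] = (map_poly (meval w) (muni p)).[v ord_max].
Proof.
move=> wE; rewrite muniE {1}[p]mpolyE !rmorph_sum /= horner_sum.
apply: eq_bigr => m _.
rewrite -mul_polyC !rmorphM /= map_polyC map_polyXn hornerM hornerC hornerXn /=.
rewrite !mevalZ -mulrA; congr (_ * _).
rewrite !mevalX big_ord_recr /=; congr (_ * _).
by apply: eq_bigr => i _; rewrite mnmE wE.
Qed.

Definition is_ideal (R : comNzRingType) (I : R -> Prop) : Prop :=
  [/\ I 0, forall x y, I x -> I y -> I (x + y) & forall a x, I x -> I (a * x)].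

Lemma ideal_sub (R : comNzRingType) (I : R -> Prop) x y :
  is_ideal I -> I x -> I y -> I (x - y).
Proof. by case=> _ ID IM Ix Iy; apply: ID => //; rewrite -mulN1r; apply: IM. Qed.

(** Finite generation is expressed without forming spans: [s] generates [I] because every ideal
    containing [s] contains [I]. *)
Definition noetherian (R : comNzRingType) : Prop :=
  forall I : R -> Prop, is_ideal I ->
  exists2 s : seq R, (forall x, x \in s -> I x) &
    forall J : R -> Prop, is_ideal J -> (forall x, x \in s -> J x) ->
      forall x, I x -> J x.

Lemma noetherian_field (K : fieldType) : noetherian K.
Proof.
move=> I [I0 ID IM].
case: (pselect (exists2 x, I x & x != 0)) => [[x Ix x0]|nex].
  exists [:: x] => [y|J [_ _ JM] Js y _]; first by rewrite inE => /eqP->.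
  by rewrite -[y](mulfVK x0); apply: JM; apply: Js; rewrite inE.
exists [::] => // J [J0 _ _] _ x Ix.
by have [->//|x0] := eqVneq x 0; case: nex; exists x.
Qed.

Lemma noetherian_surj (A B : comNzRingType) (f : {rmorphism A -> B}) :
  (forall b, exists a, f a = b) -> noetherian A -> noetherian B.
Proof.
move=> fsurj noeA I [I0 ID IM].
have [] := noeA (fun a => I (f a)).
  by split=> [|x y|a x]; rewrite ?rmorph0 ?rmorphD ?rmorphM //; auto.
move=> s sI sgen; exists (map f s) => [_ /mapP[x xs ->]|J [J0 JD JM] Js b].
  exact: sI.
have [a <-] := fsurj b; apply: (sgen (fun a => J (f a))).
  by split=> [|x y|c x]; rewrite ?rmorph0 ?rmorphD ?rmorphM //; auto.
by move=> x xs; apply: Js; apply: map_f.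
Qed.

Section HilbertBasis.

Variable R : comNzRingType.

(** Bounding the size instead of prescribing the degree admits the coefficient 0, so that an ideal
    results; it grows with [n] because [I] is stable under multiplication by ['X]. *)
Definition lead_ideal (I : {poly R} -> Prop) (n : nat) (a : R) : Prop :=
  exists f : {poly R}, [/\ I f, (size f <= n.+1)%N & f`_n = a].

Lemma lead_ideal_ideal I n : is_ideal I -> is_ideal (lead_ideal I n).
Proof.
case=> I0 ID IM; split.
- by exists 0; rewrite size_poly0 coef0.
- move=> _ _ [f [If sf <-]] [g [Ig sg <-]]; exists (f + g); split.
  + exact: ID.
  + by rewrite (leq_trans (size_polyD _ _)) // geq_max sf.
  + by rewrite coefD.
- move=> a _ [f [If sf <-]]; exists (a%:P * f); split.
  + exact: IM.
  + by rewrite mul_polyC (leq_trans (size_scale_leq _ _)).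
  + by rewrite coefCM.
Qed.

Lemma lead_ideal_le I n m a : is_ideal I -> (n <= m)%N ->
  lead_ideal I n a -> lead_ideal I m a.
Proof.
case=> I0 ID IM lenm [f [If sf fn]]; exists ('X^(m - n) * f); split.
- exact: IM.
- rewrite (leq_trans (size_polyMleq _ _)) // size_polyXn addSn /=.
  by rewrite (leq_trans (leq_add (leqnn _) sf)) // addnS subnK.
- by rewrite coefXnM ltnNge leq_subr /= subKn.
Qed.

(** Descent on the size: subtracting an element of [J] with the same leading term shortens [f].
    Taking that element in [I] as well keeps the difference in [I]. *)
Lemma poly_ideal_sub (I J : {poly R} -> Prop) :
  is_ideal I -> is_ideal J ->
  (forall n a, lead_ideal I n a -> lead_ideal (fun f => J f /\ I f) n a) ->
  forall f, I f -> J f.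
Proof.
move=> idI idJ leadIJ f; have [k] := ubnP (size f).
elim: k f => // k IHk f sf If.
have [->|f0] := eqVneq f 0; first by case: idJ.
have [|h [[Jh Ih] sh hn]] := leadIJ (size f).-1 f`_(size f).-1.
  by exists f; rewrite prednK ?size_poly_gt0.
rewrite -[f](subrK h); case: (idJ) => _ JD _; apply: JD => //.
apply: IHk; last exact: ideal_sub.
rewrite -ltnS (leq_trans _ sf) // ltnS.
apply: leq_ltn_trans (_ : (size f).-1 < _)%N; last by rewrite prednK ?size_poly_gt0.
apply/leq_sizeP => j; rewrite leq_eqVlt => /predU1P[<-|ltj].
  by rewrite coefB hn subrr.
have sf0 : (0 < size f)%N by rewrite size_poly_gt0.
by rewrite coefB !nth_default ?subrr ?(leq_trans sh) ?prednK // -(prednK sf0).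
Qed.

(** Hilbert's argument: the increasing ideals [lead_ideal I n] are constant from some [N] on, and
    polynomials realizing generators of those up to [N] generate [I]. *)
Lemma noetherian_poly : noetherian R -> noetherian {poly R}.
Proof.
move=> noeR I idI.
have lift_seq n (s : seq R) : (forall x, x \in s -> lead_ideal I n x) ->
    exists2 g : seq {poly R}, (forall f, f \in g -> I f) &
      forall J, (forall f, f \in g -> J f) ->
        forall x, x \in s -> lead_ideal J n x.
  elim: s => [|x s IHs] sI; first by exists [::].
  case: IHs => [|g gI gJ]; first by move=> y ys; apply: sI; rewrite inE ys orbT.
  have [f [If sf fn]] := sI x (mem_head _ _).
  exists (f :: g) => [h|J hJ y].
    by rewrite inE => /predU1P[->//|]; apply: gI.
  rewrite inE => /predU1P[->|ys].
    by exists f; split => //; apply: hJ; rewrite mem_head.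
  by apply: gJ ys => h hg; apply: hJ; rewrite inE hg orbT.
have lift n : exists2 g : seq {poly R}, (forall f, f \in g -> I f) &
    forall J, is_ideal J -> (forall f, f \in g -> J f) ->
      forall x, lead_ideal I n x -> lead_ideal J n x.
  have [s sI sgen] := noeR _ (lead_ideal_ideal n idI).
  have [g gI gJ] := lift_seq n s sI.
  exists g => // J idJ Jg; apply: sgen; first exact: lead_ideal_ideal.
  exact: gJ.
have liftn n : exists2 g : seq {poly R}, (forall f, f \in g -> I f) &
    forall J, is_ideal J -> (forall f, f \in g -> J f) ->
      forall m x, (m <= n)%N -> lead_ideal I m x -> lead_ideal J m x.
  elim: n => [|n [g gI gJ]].
    have [g gI gJ] := lift 0; exists g => // J idJ Jg m x.
    by rewrite leqn0 => /eqP->; apply: gJ.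
  have [h hI hJ] := lift n.+1; exists (g ++ h) => [f|J idJ Jg m x].
    by rewrite mem_cat => /orP[/gI|/hI].
  rewrite leq_eqVlt => /predU1P[->|]; last first.
    by apply: gJ => // f fg; apply: Jg; rewrite mem_cat fg.
  by apply: hJ => // f fh; apply: Jg; rewrite mem_cat fh orbT.
have [N NE] : exists N, forall n a, lead_ideal I n a -> lead_ideal I N a.
  have [|s sI sgen] := noeR (fun a => exists n, lead_ideal I n a).
    split.
    - by exists 0; have [] := lead_ideal_ideal 0 idI.
    - move=> x y [n xn] [m ym]; exists (n + m)%N.
      have [_ D _] := lead_ideal_ideal (n + m) idI.
      by apply: D; apply: lead_ideal_le idI _ _; [|exact: xn| |exact: ym];
        rewrite ?leq_addr ?leq_addl.
    - move=> a x [n xn]; exists n; have [_ _ M] := lead_ideal_ideal n idI.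
      exact: M.
  have {sI} [N sN] : exists N, forall x, x \in s -> lead_ideal I N x.
    elim: s sI {sgen} => [|x s IHs] sI; first by exists 0.
    case: IHs => [|N sN]; first by move=> y ys; apply: sI; rewrite inE ys orbT.
    have [n xn] := sI x (mem_head _ _).
    exists (N + n)%N => y; rewrite inE => /predU1P[->|/sN ys].
      exact: lead_ideal_le (leq_addl _ _) xn.
    exact: lead_ideal_le (leq_addr _ _) ys.
  exists N => n a na; apply: (sgen _ (lead_ideal_ideal N idI) sN).
  by exists n.
have [g gI gJ] := liftn N; exists g => // J idJ Jg.
apply: poly_ideal_sub => // n a na.
have idJI : is_ideal (fun f => J f /\ I f).
  case: idI idJ => I0 ID IM [J0 JD JM]; split; first by [].
    by move=> x y [] ? ? [] ? ?; split; auto.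
  by move=> x y [] ? ?; split; auto.
have JIg f : f \in g -> J f /\ I f by move=> fg; split; [exact: Jg|exact: gI].
have [leN|ltN] := leqP n N; first exact: (gJ _ idJI JIg).
apply: (lead_ideal_le idJI (ltnW ltN)); apply: (gJ _ idJI JIg) => //.
exact: NE na.
Qed.

End HilbertBasis.

Lemma noetherian_mpoly (K : fieldType) n : noetherian {mpoly K[n]}.
Proof.
elim: n => [|n IHn].
  apply: (noetherian_surj (f := @mpolyC 0 K)); last exact: noetherian_field.
  move=> p; exists p@_0%MM; apply/mpolyP => m; rewrite mcoeffC.
  have -> : m = 0%MM by apply/mnmP; case.
  by rewrite eqxx mulr1.
pose f := horner_eval ('X_ord_max : {mpoly K[n.+1]}) \o map_poly (@mwiden n K).
apply: (noetherian_surj (f := f)); last exact: noetherian_poly.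
by move=> p; exists (muni p); rewrite /f /= /horner_eval mmulti_muni.
Qed.

(** * Extension of specializations *)

Lemma ex_minimal (T : Type) (P : T -> Prop) (mu : T -> nat) x0 :
  P x0 -> exists2 x, P x & forall y, P y -> (mu x <= mu y)%N.
Proof.
move=> Px0; have [k] := ubnP (mu x0).
elim: k x0 Px0 => // k IHk x Px; rewrite ltnS => xk.
have [[y Py yx]|min] := pselect (exists2 y, P y & (mu y < mu x)%N).
  by apply: IHk Py _; apply: leq_trans yx xk.
by exists x => // y Py; rewrite leqNgt; apply/negP => yx; apply: min; exists y.
Qed.

Lemma closed_nonroot (K : closedFieldType) (p : {poly K}) :
  p != 0 -> exists c, ~~ root p c.
Proof.
move=> p0; apply/closed_nonrootP; exact: p0.
Qed.

Section Extension.

Variables (R : idomainType) (P : {poly R} -> Prop).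
Hypotheses (idP : is_ideal P) (primeP : forall f g, P (f * g) -> P f \/ P g).

Let cP (c : R) := P c%:P.

Lemma prime_exp c n : ~ cP c -> ~ cP (c ^+ n).
Proof.
move=> nc; elim: n => [|n IHn]; rewrite /cP.
  rewrite expr0 => P1; apply: nc; case: idP => _ _ PM.
  by rewrite /cP -[c%:P]mulr1; apply: PM.
by rewrite exprS polyCM => /primeP[].
Qed.

(** Leading terms with coefficient in [P] belong to [J]; they are stripped until one outside [P]
    comes first. *)
Lemma lead_notin (J : {poly R} -> Prop) f :
  is_ideal J -> (forall c, cP c -> J c%:P) -> J f -> (exists i, ~ cP f`_i) ->
  exists g, [/\ J g, ~ cP (lead_coef g) & (size g <= size f)%N].
Proof.
move=> idJ PJ; have [k] := ubnP (size f).
elim: k f => // k IHk f sf Jf [i nPi].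
have [Pl|nPl] := pselect (cP (lead_coef f)); last by exists f.
have f0 : f != 0.
  by apply/eqP => f0; apply: nPi; rewrite f0 coef0; case: idP.
pose g := f - (lead_coef f)%:P * 'X^((size f).-1).
have sf0 : (0 < size f)%N by rewrite size_poly_gt0.
have gE j : g`_j = if j == (size f).-1 then 0 else f`_j.
  rewrite coefB coefCM coefXn; case: eqP => [->|_]; first by rewrite mulr1 subrr.
  by rewrite mulr0 subr0.
have sg : (size g < size f)%N.
  rewrite -(prednK sf0) ltnS; apply/leq_sizeP => j lej; rewrite gE.
  case: eqP => // /eqP jn; rewrite nth_default // -(prednK sf0).
  by rewrite ltn_neqAle eq_sym jn.
have [|||j [Jj nPj sj]] := IHk g; first exact: leq_trans sg sf.
- apply: ideal_sub => //; rewrite mulrC; case: idJ => _ _; apply; exact: PJ.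
- exists i; rewrite gE; case: eqP => // ei.
  by case: nPi; rewrite ei.
- by exists j; split => //; apply: leq_trans sj (ltnW sg).
Qed.

Lemma coef_notin (f : {poly R}) : ~ P f -> exists i, ~ cP f`_i.
Proof.
move=> nPf; apply: contrapT => all_in; apply: nPf.
rewrite -[f]coefK poly_def; case: idP => P0 PD PM.
apply: (big_ind P) => // i _; rewrite -mul_polyC mulrC; apply: PM.
by apply: contrapT => nPi; apply: all_in; exists i.
Qed.

(** Here [b] is the image of ['X] under an extension of [psi] that kills [P] but not [g]. If ['X] is
    transcendental modulo [P], then [c] is a coefficient of [g] and [b] a non-root. Otherwise [b] is
    a root of the image of [f], an element of [P] of least degree among those with leading
    coefficient outside [P]. *)
Lemma extend_specialization (K : closedFieldType) (g : {poly R}) : ~ P g ->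
  exists2 c : R, ~ cP c &
  forall psi : {rmorphism R -> K}, (forall r, cP r -> psi r = 0) -> psi c != 0 ->
  exists2 b : K, (forall f, P f -> (map_poly psi f).[b] = 0) &
    (map_poly psi g).[b] != 0.
Proof.
move=> nPg; have [P0 PD PM] := idP.
have [allP|] := pselect (forall f i, P f -> cP f`_i).
  have [i nPi] := coef_notin nPg; exists g`_i => // psi psiP gi0.
  have [|b nb] := @closed_nonroot K (map_poly psi g).
    by apply: contraNneq gi0 => g0; rewrite -coef_map g0 coef0.
  exists b; last by [].
  move=> f Pf; suff -> : map_poly psi f = 0 by rewrite horner0.
  by apply/polyP => j; rewrite coef_map coef0; apply/psiP/allP.
move=> /existsNP[f0 /existsNP[i0 /not_implyP[Pf0 nPi0]]].
have [|||f1 [Pf1 nPl1 _]] := @lead_notin P f0 idP; [by []|by []|by exists i0|].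
have [f [Pf nPl] fmin] := @ex_minimal _ (fun f => P f /\ ~ cP (lead_coef f))
  (fun f => size f) f1 (conj Pf1 nPl1).
have small_in r : P r -> (size r < size f)%N -> forall i, cP r`_i.
  move=> Pr sr i; apply: contrapT => nPi.
  have [|||r' [Pr' nPr' sr']] := @lead_notin P r idP; [by []|by []|by exists i|].
  by have := leq_trans (fmin r' (conj Pr' nPr')) sr'; rewrite leqNgt sr.
have sf : (1 < size f)%N.
  rewrite ltnNge; apply/negP => /size1_polyC fC; apply: nPl.
  by rewrite fC lead_coefC /cP -fC.
have f_neq0 : f != 0 by rewrite -size_poly_gt0 ltnW.
(* An element of minimal degree in the ideal spanned by P and g turns out to  *)
(* be a constant w0: g is invertible modulo P once w0 is inverted.            *)
pose J (w : {poly R}) := exists i v : {poly R}, P i /\ w = i + v * g.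
have idJ : is_ideal J.
  split; first by exists 0, 0; rewrite mul0r addr0.
    move=> _ _ [i [v [Pi ->]]] [j [u [Pj ->]]]; exists (i + j), (v + u).
    by split; [exact: PD|rewrite mulrDl addrACA].
  move=> a _ [i [v [Pi ->]]]; exists (a * i), (a * v).
  by split; [exact: PM|rewrite mulrDr mulrA].
have PJ h : P h -> J h by move=> Ph; exists h, 0; rewrite mul0r addr0.
have Jg : J g by exists 0, 1; rewrite mul1r add0r.
have [w [Jw nPw] wmin] := @ex_minimal _ (fun f => J f /\ ~ cP (lead_coef f))
  (fun f => size f) f (conj (PJ f Pf) nPl).
have w_neq0 : w != 0.
  by apply/eqP => w0; apply: nPw; rewrite w0 lead_coef0.
have mod_in (h : {poly R}) : J h -> P (h %% w).
  move=> Jh; apply: contrapT => nPr.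
  have [|||r [Jr nPr' sr]] := @lead_notin J (h %% w) idJ.
  - by move=> c Pc; apply: PJ.
  - have -> : h %% w = (lead_coef w ^+ scalp h w)%:P * h - h %/ w * w.
      by rewrite mul_polyC Pdiv.Idomain.divp_eq addrC addKr.
    by apply: ideal_sub => //; case: idJ => _ _; apply.
  - exact: coef_notin.
  have := leq_trans (wmin r (conj Jr nPr')) sr.
  by rewrite leqNgt Pdiv.Idomain.ltn_modp w_neq0.
have P_lin (h : {poly R}) : J h -> P (h %/ w * w) -> P h.
  move=> Jh Pq; have : P ((lead_coef w ^+ scalp h w)%:P * h).
    by rewrite mul_polyC Pdiv.Idomain.divp_eq; apply: PD => //; apply: mod_in.
  by case/primeP => // /prime_exp.
have nPw' : ~ P w.
  by move=> Pw; apply: nPg; apply: P_lin => //; apply: PM.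
(* If [w] had positive degree, the quotient [f %/ w], which lies in [P] because [w] does not, would
   be shorter than [f]. Its leading coefficient would then lie in [P], and by primality so would
   that of [f]. *)
have sw : size w = 1%N.
  have : P (f %/ w * w).
    have -> : f %/ w * w = (lead_coef w ^+ scalp f w)%:P * f - f %% w.
      by rewrite mul_polyC Pdiv.Idomain.divp_eq addrK.
    by apply: ideal_sub => //; [apply: PM|apply: mod_in; apply: PJ].
  case/primeP => // Pq; apply/eqP; rewrite eqn_leq [X in _ && X]size_poly_gt0 w_neq0.
  rewrite andbT leqNgt; apply/negP => sw.
  have sq : (size (f %/ w)%R < size f)%N.
    by rewrite Pdiv.Idomain.size_divp // ltn_subrL (ltnW sf) andbT -subn1 subn_gt0.
  have Pl : cP (lead_coef (f %/ w)) by apply: small_in.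
  have srf : (size (f %% w)%R < size f)%N.
    rewrite (leq_trans (_ : _ < size w)%N) ?Pdiv.Idomain.ltn_modp //.
    exact: (wmin f (conj (PJ f Pf) nPl)).
  have : cP (lead_coef w ^+ scalp f w * lead_coef f).
    suff -> : lead_coef w ^+ scalp f w * lead_coef f =
        lead_coef w * lead_coef (f %/ w).
      by rewrite /cP polyCM; apply: PM.
    rewrite [RHS]mulrC -lead_coefM -[f %/ w * w](addrK (f %% w)) -Pdiv.Idomain.divp_eq.
    rewrite lead_coefDl ?lead_coefZ // size_polyN size_scale //.
    by rewrite expf_neq0 // lead_coef_eq0.
  by rewrite /cP polyCM => /primeP[/prime_exp|].
have [i [v [Pi wE]]] := Jw.
have [w0 w0E] : exists w0, w = w0%:P by exists w`_0; apply: size1_polyC; rewrite sw.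
(* The factor [w0] keeps [g] from vanishing at [b]; the leading coefficient keeps the degree of [f]
   under [psi], so that the image has a root. *)
exists (w0 * lead_coef f).
  rewrite /cP polyCM => /primeP[]; last by [].
  by rewrite -w0E.
move=> psi psiP; rewrite rmorphM mulf_eq0 negb_or => /andP[psi_w psi_l].
have sf_psi : size (map_poly psi f) = size f by rewrite size_map_poly_id0.
have [b /eqP b_root] : exists b, root (map_poly psi f) b.
  by apply/closed_rootP; rewrite sf_psi gtn_eqF.
have vanish h : P h -> (map_poly psi h).[b] = 0.
  move=> Ph; have : (map_poly psi (lead_coef f ^+ scalp h f *: h)).[b] = 0.
    rewrite Pdiv.Idomain.divp_eq rmorphD rmorphM /=.
    rewrite hornerD hornerM b_root mulr0 add0r /=.
    have Pmod : P (h %% f).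
      have -> : h %% f = (lead_coef f ^+ scalp h f)%:P * h - h %/ f * f.
        by rewrite mul_polyC Pdiv.Idomain.divp_eq addrC addKr.
      by apply: ideal_sub => //; apply: PM.
    suff -> : map_poly psi (h %% f) = 0 by rewrite horner0.
    apply/polyP => j; rewrite coef_map coef0; apply: psiP.
    by apply: small_in; rewrite ?Pdiv.Idomain.ltn_modp.
  rewrite map_polyZ hornerZ rmorphXn => /eqP.
  by rewrite mulf_eq0 expf_eq0 (negPf psi_l) andbF => /eqP.
exists b => //.
apply: contraNneq psi_w => gb.
have := congr1 (fun u => (map_poly psi u).[b]) wE.
rewrite rmorphD rmorphM /= hornerD hornerM gb mulr0 addr0 (vanish _ Pi).
by rewrite w0E map_polyC hornerC => ->.
Qed.

End Extension.

(** * Zariski topology and chains of irreducible sets *)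

Definition peval (K : comNzRingType) (d : nat) (f : {mpoly K[d]}) (x : 'rV[K]_d) : K :=
  f.@[fun i => x 0 i].

Lemma pevalM (K : comNzRingType) (d : nat) (f g : {mpoly K[d]}) x :
  peval (f * g) x = peval f x * peval g x.
Proof. exact: mevalM. Qed.

Lemma pevalB (K : comNzRingType) (d : nat) (f g : {mpoly K[d]}) x :
  peval (f - g) x = peval f x - peval g x.
Proof. exact: mevalB. Qed.

Lemma pevalC (K : comNzRingType) (d : nat) (c : K) (x : 'rV[K]_d) :
  peval c%:MP x = c.
Proof. exact: mevalC. Qed.

Section Zariski.

Local Open Scope classical_set_scope.

Variables (K : fieldType) (d : nat).
Implicit Types (X Y W U : set 'rV[K]_d) (f g : {mpoly K[d]}).

Definition vanishing X f : Prop := forall x, X x -> peval f x = 0.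

Definition zclosed X : Prop :=
  forall x, (forall f, vanishing X f -> peval f x = 0) -> X x.

(** Irreducibility as primality of the vanishing ideal, the form that [extend_specialization] takes;
    [zirreducible_cover] recovers the topological form. *)
Definition zirreducible X : Prop :=
  [/\ zclosed X, X !=set0 &
      forall f g, vanishing X (f * g) -> vanishing X f \/ vanishing X g].

Lemma vanishing_ideal X : is_ideal (vanishing X).
Proof.
split=> [x _|f g Xf Xg x Xx|f g Xg x Xx]; rewrite /peval ?meval0 //.
  by rewrite mevalD -!/(peval _ _) Xf // Xg // addr0.
by rewrite mevalM -!/(peval _ _) Xg // mulr0.
Qed.

Lemma vanishing_sub X Y f : X `<=` Y -> vanishing Y f -> vanishing X f.
Proof. by move=> XY Yf x /XY/Yf. Qed.

Lemma zclosedI X Y : zclosed X -> zclosed Y -> zclosed (X `&` Y).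
Proof.
move=> cX cY x XYx; split; [apply: cX => f Xf|apply: cY => f Yf]; apply: XYx.
  exact: vanishing_sub Xf.
exact: vanishing_sub Yf.
Qed.

Lemma zclosed_zeros f : zclosed [set x | peval f x = 0].
Proof. by move=> x; apply. Qed.

Lemma zclosed_subset X Y : zclosed Y ->
  (forall f, vanishing Y f -> vanishing X f) -> X `<=` Y.
Proof. by move=> cY YX x Xx; apply: cY => f /YX; apply. Qed.

Lemma not_subset X Y : zclosed Y -> ~ X `<=` Y ->
  exists2 f, vanishing Y f & ~ vanishing X f.
Proof.
move=> cY nXY; apply: contrapT => nf; apply: nXY; apply: zclosed_subset => //.
by move=> f Yf; apply: contrapT => nXf; apply: nf; exists f.
Qed.

Lemma not_vanishing X f : ~ vanishing X f -> exists2 x, X x & peval f x != 0.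
Proof.
move=> /existsNP[x /not_implyP[Xx fx]]; exists x => //; exact/eqP.
Qed.

(** Otherwise each [Y] carries a function vanishing on it but not on [W], and the product of these
    vanishes on [W], against primality. *)
Lemma zirreducible_cover W (Ys : seq (set 'rV[K]_d)) : zirreducible W ->
  (forall Y, Y \in Ys -> zclosed Y) ->
  (forall x, W x -> exists2 Y, Y \in Ys & Y x) ->
  exists2 Y, Y \in Ys & W `<=` Y.
Proof.
move=> irrW cYs cov; apply: contrapT => nsub.
suff [f nWf Ysf] : exists2 f, ~ vanishing W f &
    forall Y, Y \in Ys -> vanishing Y f.
  by apply: nWf => x Wx; have [Y YYs Yx] := cov x Wx; apply: Ysf Yx.
have {cov} : forall Y, Y \in Ys -> zclosed Y /\ ~ W `<=` Y.
  by move=> Y YYs; split; [exact: cYs|move=> WY; apply: nsub; exists Y].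
elim: Ys {cYs nsub} => [|Y Ys IHYs] sep.
  have [_ [w Ww] _] := irrW; exists 1 => [/(_ w Ww)/eqP|//].
  by rewrite /peval meval1 oner_eq0.
have [|f nWf Ysf] := IHYs; first by move=> Z ZYs; apply: sep; rewrite inE ZYs orbT.
have [cY nWY] := sep Y (mem_head _ _).
have [g Yg nWg] := not_subset cY nWY.
exists (g * f) => [|Z].
  by have [_ _ prW] := irrW; case/prW.
rewrite inE => /predU1P[->|/Ysf Zf] x Zx; rewrite pevalM.
  by rewrite Yg // mul0r.
by rewrite Zf // mulr0.
Qed.

(** Noetherian induction: along an infinite strictly decreasing sequence, finitely many generators
    of the union of the vanishing ideals would already vanish at some stage, where the sequence
    would have to stop. *)
Lemma zclosed_ind (P : set 'rV[K]_d -> Prop) :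
  (forall X, zclosed X -> (forall Y, zclosed Y -> Y `<` X -> P Y) -> P X) ->
  forall X, zclosed X -> P X.
Proof.
move=> IH X cX; apply: contrapT => nPX.
pose T := {Y : set 'rV[K]_d | zclosed Y /\ ~ P Y}.
have step (Y : T) : {Z : T | sval Z `<` sval Y}.
  apply: cid; case: Y => Y [cY nPY] /=; apply: contrapT => nZ; apply: nPY.
  apply: IH => // Z cZ ZY; apply: contrapT => nPZ; apply: nZ.
  by exists (exist _ Z (conj cZ nPZ)).
pose Xs n := sval (iter n (fun Y : T => sval (step Y)) (exist _ X (conj cX nPX) : T)).
have XsS n : Xs n.+1 `<` Xs n by rewrite /Xs /=; case: (step _).
have Xs_le m n : (m <= n)%N -> Xs n `<=` Xs m.
  move=> /subnK <-; elim: (n - m)%N => // k IHk.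
  by apply: subset_trans IHk; have [] := XsS (k + m)%N.
have [|s sI sgen] := @noetherian_mpoly K d (fun f => exists n, vanishing (Xs n) f).
  split.
  - by exists 0%N; have [] := vanishing_ideal (Xs 0%N).
  - move=> f g [n nf] [m mg]; exists (n + m)%N.
    have [_ D _] := vanishing_ideal (Xs (n + m)%N); apply: D.
      exact: vanishing_sub (Xs_le _ _ (leq_addr _ _)) nf.
    exact: vanishing_sub (Xs_le _ _ (leq_addl _ _)) mg.
  - by move=> a f [n nf]; exists n; have [_ _] := vanishing_ideal (Xs n); apply.
have [N sN] : exists N, forall f, f \in s -> vanishing (Xs N) f.
  elim: s sI {sgen} => [|f s IHs] sI; first by exists 0%N.
  have [|N sN] := IHs; first by move=> g gs; apply: sI; rewrite inE gs orbT.
  have [n nf] := sI f (mem_head _ _); exists (N + n)%N => g.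
  rewrite inE => /predU1P[->|/sN].
    exact: vanishing_sub (Xs_le _ _ (leq_addl _ _)) nf.
  exact: vanishing_sub (Xs_le _ _ (leq_addr _ _)).
have [_ []] := XsS N; apply: zclosed_subset.
  by rewrite /Xs; case: (iter _ _ _) => Y [].
move=> f fN; apply: (sgen _ (vanishing_ideal (Xs N)) sN); by exists N.+1.
Qed.

Lemma zclosed_components X : zclosed X ->
  exists2 Ys : seq (set 'rV[K]_d),
    (forall Y, Y \in Ys -> zirreducible Y /\ Y `<=` X) &
    forall x, X x -> exists2 Y, Y \in Ys & Y x.
Proof.
move: X; apply: zclosed_ind => X cX IHX.
have [[x0 X0]|nX] := pselect (X !=set0); last first.
  by exists [::] => // x Xx; case: nX; exists x.
have [prX|] := pselect (forall f g, vanishing X (f * g) ->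
    vanishing X f \/ vanishing X g).
  exists [:: X] => [Y|x Xx]; last by exists X; rewrite ?mem_head.
  by rewrite inE => /eqP->; split => //; split => //; exists x0.
move=> /existsNP[f /existsNP[g /not_implyP[Xfg /not_orP[nXf nXg]]]].
have cut h : ~ vanishing X h -> exists2 Ys : seq (set 'rV[K]_d),
    (forall Y, Y \in Ys -> zirreducible Y /\ Y `<=` X) &
    forall x, X x -> peval h x = 0 -> exists2 Y, Y \in Ys & Y x.
  move=> nXh; have [||Ys YsX cov] := IHX (X `&` [set x | peval h x = 0]).
  - by apply: zclosedI => //; apply: zclosed_zeros.
  - by split=> [x []|Xh] //; apply: nXh => x /Xh[].
  - by exists Ys => [Y /YsX[irrY YX]|x Xx hx]; [split=> // y /YX[]|apply: cov].
have [Ys YsX covY] := cut f nXf; have [Zs ZsX covZ] := cut g nXg.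
exists (Ys ++ Zs) => [Y|x Xx]; first by rewrite mem_cat => /orP[/YsX|/ZsX].
have := Xfg x Xx; rewrite pevalM => /eqP.
rewrite mulf_eq0 => /orP[]/eqP.
  by move=> /(covY x Xx)[Y YYs Yx]; exists Y; rewrite // mem_cat YYs.
by move=> /(covZ x Xx)[Y YZs Yx]; exists Y; rewrite // mem_cat YZs orbT.
Qed.

Lemma zclosed_point (p : 'rV[K]_d) : zclosed [set p].
Proof.
move=> x px /=; apply/rowP => i; have := px ('X_i - (p 0 i)%:MP).
rewrite /vanishing /peval mevalB mevalXU mevalC => /(_ _)/eqP; rewrite subr_eq0.
move=> H; apply/eqP/H => _ ->; rewrite mevalB mevalXU mevalC subrr //.
Qed.

Lemma zirreducible_point (p : 'rV[K]_d) : zirreducible [set p].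
Proof.
split; [exact: zclosed_point|by exists p|].
move=> f g /(_ p erefl); rewrite /peval mevalM => /eqP.
by rewrite mulf_eq0 => /orP[]/eqP p0; [left|right] => _ ->.
Qed.

(** * Dimension through chains of irreducible closed sets over [K] *)

Inductive zheight_ge : nat -> set 'rV[K]_d -> Prop :=
| zheight0 W : zirreducible W -> zheight_ge 0 W
| zheightS m U W : zheight_ge m U -> zirreducible W -> U `<` W ->
    zheight_ge m.+1 W.

Lemma zheight_irr m W : zheight_ge m W -> zirreducible W.
Proof. by case. Qed.

Definition zdim_le X (m : nat) : Prop :=
  forall W, W `<=` X -> ~ zheight_ge m.+1 W.

(** A set of height [m] lies in some member of a finite decomposition, and equals it, since a strict
    inclusion would give height [m.+1]. *)
Lemma zheight_finite X m : zclosed X -> zdim_le X m ->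
  exists2 Ws : seq (set 'rV[K]_d), uniq Ws &
    forall W, W \in Ws <-> zheight_ge m W /\ W `<=` X.
Proof.
move=> cX dX; have [Ys YsX cov] := zclosed_components cX.
exists (undup [seq W <- Ys | `[< zheight_ge m W >]]); first exact: undup_uniq.
move=> W; rewrite mem_undup mem_filter; split.
  by move=> /andP[/asboolP hW /YsX[]].
move=> [hW WX]; have irrW := zheight_irr hW.
apply/andP; split; first exact/asboolP.
have [||Y YYs WY] := @zirreducible_cover W Ys irrW.
- by move=> Y /YsX[[]].
- by move=> x /WX/cov.
suff -> : W = Y by [].
have [irrY YX] := YsX Y YYs; apply/seteqP; split => //.
by apply: contrapT => nYW; apply: (dX Y) => //; apply: zheightS hW _ _.
Qed.

Lemma zdim0_finite X : zclosed X -> zdim_le X 0 ->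
  exists2 s : seq 'rV[K]_d, uniq s & forall x, X x <-> x \in s.
Proof.
move=> cX dX; have [Ys YsX cov] := zclosed_components cX.
have single Y : Y \in Ys -> exists p, Y = [set p].
  move=> /YsX[irrY YX]; have [_ [p Yp] _] := irrY; exists p.
  apply/seteqP; split => [|x ->//]; apply: contrapT => nYp.
  apply: (dX Y) => //; apply: zheightS (zheight0 (zirreducible_point p)) _ _ => //.
  by split => // x ->.
have [s sE] : exists s : seq 'rV[K]_d,
    forall x, x \in s <-> exists2 Y, Y \in Ys & Y x.
  elim: Ys {YsX cov} single => [|Y Ys IHYs] single.
    by exists [::] => x; split => // -[].
  have [|s sE] := IHYs; first by move=> Z ZYs; apply: single; rewrite inE ZYs orbT.
  have [p YE] := single Y (mem_head _ _); exists (p :: s) => x.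
  rewrite inE; split=> [/predU1P[->|/sE[Z ZYs Zx]]|[Z]].
  - by exists Y; rewrite ?mem_head // YE.
  - by exists Z; rewrite // inE ZYs orbT.
  - rewrite inE => /predU1P[->|ZYs Zx]; first by rewrite YE => ->; rewrite eqxx.
    by apply/orP; right; apply/sE; exists Z.
exists (undup s) => [|x]; first exact: undup_uniq.
rewrite mem_undup; split=> [/cov/sE//|/sE[Y /YsX[_ YX]]]; exact: YX.
Qed.

End Zariski.

(** * Algebraic independence and hyperplane sections *)

Section Independence.

Local Open Scope classical_set_scope.

Variables (K : closedFieldType) (d : nat).
Implicit Types (W U : set 'rV[K]_d) (y z : nat -> {mpoly K[d]}).

Lemma closed_notin (s : seq K) : exists c, c \notin s.
Proof.
have [|c nc] := @closed_nonroot K (\prod_(a <- s) ('X - a%:P)).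
  by rewrite monic_neq0 // monic_prod_XsubC.
by exists c; rewrite root_prod_XsubC in nc.
Qed.

Lemma mpoly0_const (p : {mpoly K[0]}) : p = (p@_0%MM)%:MP.
Proof.
apply/mpolyP => m; rewrite mcoeffC.
have -> : m = 0%MM by apply/mnmP; case.
by rewrite eqxx mulr1.
Qed.

(** An algebraically closed field is infinite. Assignments on all of [nat] serve every number of
    variables at once. *)
Lemma mpoly_eq0_eval n (p : {mpoly K[n]}) :
  (forall v : nat -> K, p.@[fun i : 'I_n => v i] = 0) -> p = 0.
Proof.
elim: n p => [|n IHn] p p0.
  have := p0 (fun=> 0); rewrite [p]mpoly0_const mevalC => ->.
  by rewrite mpolyC0.
apply/eqP; rewrite -muni_eq0; apply/eqP/polyP => k; rewrite coef0.
apply: IHn => v; pose q := map_poly (meval (fun i : 'I_n => v i)) (muni p).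
suff q0 : q = 0 by rewrite -coef_map -/q q0 coef0.
apply/eqP/negPn/negP => /closed_nonroot[b /negP]; apply.
have := p0 (fun i => if i == n then b else v i).
rewrite (@meval_muni _ _ _ _ (fun i : 'I_n => v i)) /= ?eqxx -/q.
  by move/eqP.
by move=> i; rewrite ltn_eqF.
Qed.

Definition alg_indep W N y : Prop :=
  forall P : {mpoly K[N]},
    (forall x, W x -> P.@[fun i : 'I_N => peval (y i) x] = 0) -> P = 0.

Lemma eq_alg_indep W N y z : (forall i, (i < N)%N -> y i = z i) ->
  alg_indep W N y -> alg_indep W N z.
Proof.
move=> yz Wy P Pz; apply: Wy => x Wx; rewrite -(Pz x Wx).
by apply: meval_eq => i; rewrite yz.
Qed.

Lemma alg_indep0 W y : W !=set0 -> alg_indep W 0 y.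
Proof.
move=> [x Wx] P /(_ x Wx); rewrite [P]mpoly0_const mevalC => ->.
by rewrite mpolyC0.
Qed.

Lemma alg_indep_perm W N y (s s' : nat -> nat) :
  (forall i, (i < N)%N -> (s i < N)%N) ->
  (forall i, (i < N)%N -> (s' (s i) = i)%N) ->
  alg_indep W N y -> alg_indep W N (y \o s).
Proof.
case: N => [|N] sN s'K Wy P Pys.
  apply: mpoly_eq0_eval => v; rewrite [P]mpoly0_const mevalC.
  have := Wy ((P@_0)%:MP); rewrite -[in X in X -> _]mpoly0_const => ->.
    by rewrite mcoeff0.
  by move=> x Wx; rewrite -(Pys x Wx); apply: meval_eq; case.
pose Q := P \mPo [tuple ('X_(inord (s i)) : {mpoly K[N.+1]}) | i < N.+1].
have Qeval (v : nat -> K) : Q.@[fun i => v i] = P.@[fun i : 'I_N.+1 => v (s i)].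
  rewrite comp_mpoly_meval; apply: meval_eq => i.
  by rewrite tnth_mktuple mevalXU inordK // sN.
have Q0 : Q = 0.
  apply: Wy => x Wx; rewrite -[RHS](Pys x Wx).
  exact: (Qeval (fun i => peval (y i) x)).
apply: mpoly_eq0_eval => v.
have := Qeval (v \o s'); rewrite Q0 meval0 => /esym; rewrite -[RHS]/0 => <-.
by apply: meval_eq => i /=; rewrite s'K.
Qed.

Definition eval_last z N (q : {poly {mpoly K[N]}}) : {mpoly K[d]} :=
  (horner_eval (z N) \o map_poly (comp_mpoly [tuple z i | i < N])) q.

Lemma peval_eval_last z N (q : {poly {mpoly K[N]}}) x :
  peval (eval_last z q) x =
  (map_poly (meval (fun i : 'I_N => peval (z i) x)) q).[peval (z N) x].
Proof.
rewrite /eval_last /= /horner_eval /peval -horner_map -map_poly_comp.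
congr (_.[_]); apply: eq_map_poly => P /=.
by rewrite comp_mpoly_meval; apply: meval_eq => i; rewrite tnth_mktuple.
Qed.

Lemma peval_eval_last_muni z N (P : {mpoly K[N.+1]}) x :
  peval (eval_last z (muni P)) x = P.@[fun i : 'I_N.+1 => peval (z i) x].
Proof.
by rewrite peval_eval_last (@meval_muni _ _ P _ (fun i : 'I_N => peval (z i) x)).
Qed.

(* In a relation between the y_i and g on W, the constant term in g vanishes  *)
(* on U, hence is 0, so that the relation can be divided by g.                *)
Lemma alg_indep_extend U W N y g : alg_indep U N y -> U `<=` W ->
  zirreducible W -> vanishing U g -> ~ vanishing W g ->
  alg_indep W N.+1 (fun i => if i == N then g else y i).
Proof.
move=> Uy UW irrW Ug nWg P; pose z i := if i == N then g else y i.
rewrite -/z => PW.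
have {}Uy : alg_indep U N z.
  by apply: eq_alg_indep Uy => i iN; rewrite /z ltn_eqF.
have zN : z N = g by rewrite /z eqxx.
have : vanishing W (eval_last z (muni P)).
  by move=> x Wx; rewrite peval_eval_last_muni PW.
move=> WP; apply/eqP; rewrite -muni_eq0; move: (muni P) WP; clear PW P.
apply: poly_ind => [_|q c IHq Wq]; first by rewrite eqxx.
have c0 : c = 0.
  apply: Uy => x Ux; have := Wq x (UW x Ux).
  rewrite peval_eval_last rmorphD rmorphM /= map_polyX map_polyC hornerMXaddC.
  by rewrite zN Ug // mulr0 add0r.
rewrite c0 polyC0 addr0 in Wq *.
have [_ _ prW] := irrW; rewrite mulf_eq0 IHq //.
have : vanishing W (eval_last z q * g).
  move=> x Wx; rewrite -(Wq x Wx) pevalM.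
  by rewrite !peval_eval_last rmorphM /= map_polyX hornerMX zN.
by case/prW.
Qed.

(** Each strict inclusion of the chain supplies a function vanishing on the smaller set but not on
    the larger, which [alg_indep_extend] adjoins. At the lowest inclusion the function is free, as
    long as it vanishes at [p] and not at [q]. *)
Lemma zheight_indep m W : zheight_ge m.+1 W ->
  exists p q : 'rV[K]_d, [/\ W p, W q, p != q &
    forall g, peval g p = 0 -> peval g q != 0 ->
      exists2 y, alg_indep W m.+1 y & y m = g].
Proof.
elim: m W => [|m IHm] W; inversion 1 as [|k U W' hU irrW [UW nWU]].
  have [_ [p Up] _] := zheight_irr hU.
  have [q Wq nUq] : exists2 q, W q & ~ U q.
    apply: contrapT => nq; apply: nWU => x Wx; apply: contrapT => nUx.
    by apply: nq; exists x.
  exists p, q; split => //; first exact: UW.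
    by apply/eqP => pq; apply: nUq; rewrite -pq.
  move=> g gp gq; exists (fun i => if i == 0%N then g else 0) => //.
  apply: (@alg_indep_extend [set p] W 0 (fun=> 0)) => //.
  - by apply: alg_indep0; exists p.
  - by move=> _ ->; apply: UW.
  - by move=> _ ->.
  - by move=> /(_ q Wq)/eqP; apply/negP.
have [p [q [Up Uq pq sep]]] := IHm U hU.
have [cU _ _] := zheight_irr hU; have [g Ug nWg] := not_subset cU nWU.
exists p, q; split; [exact: UW|exact: UW|exact: pq|].
move=> f fp fq; have [y Uy ym] := sep f fp fq.
(* [alg_indep_extend] appends the new function at index [m.+1]; this swap brings [f] back to the
   last place. *)
pose s i := if i == m then m.+1 else if i == m.+1 then m else i.
have sm : s m.+1 = m by rewrite /s eqxx; case: eqP => // /eqP; rewrite gtn_eqF.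
have sK i : s (s i) = i.
  rewrite /s; have [->|im] := eqVneq i m; first by rewrite eqxx gtn_eqF.
  by have [->|im1] := eqVneq i m.+1; rewrite ?eqxx // (negPf im) (negPf im1).
eexists; first apply: (@alg_indep_perm _ _ _ s s) => [i|i _|].
- by rewrite /s; case: eqP => // _; case: eqP => // _ _; rewrite ltnS ltnW.
- exact: sK.
- exact: alg_indep_extend Uy UW irrW Ug nWg.
- by rewrite /= sm ltn_eqF.
Qed.

Section Specialization.

Variables (W : set 'rV[K]_d) (z : nat -> {mpoly K[d]}).
Hypothesis irrW : zirreducible W.

Definition relation N (P : {mpoly K[N]}) : Prop :=
  forall x, W x -> P.@[fun i : 'I_N => peval (z i) x] = 0.

(** Geometrically, [a] gives a point in the closure of the image of [W] in [K^N] under the first [N]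
    functions [z]. *)
Definition specialization N (a : nat -> K) : Prop :=
  forall P : {mpoly K[N]}, relation P -> P.@[fun i : 'I_N => a i] = 0.

(** This is [extend_specialization] over [{mpoly K[N]}], for the prime ideal of relations among the
    first [N.+1] functions, with the last one as the variable. *)
Lemma specialization_step N (g : {mpoly K[N.+1]}) : ~ relation g ->
  exists2 h : {mpoly K[N]}, ~ relation h &
  forall a, specialization N a -> h.@[fun i => a i] != 0 ->
  exists a', [/\ forall i, (i < N)%N -> a' i = a i, specialization N.+1 a' &
    g.@[fun i => a' i] != 0].
Proof.
move=> nWg; pose P (q : {poly {mpoly K[N]}}) := vanishing W (eval_last z q).
have [V0 VD VM] := vanishing_ideal W.
have idP : is_ideal P.
  split=> [|p q Pp Pq|p q Pq]; rewrite /P /eval_last.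
  - by rewrite raddf0.
  - by rewrite raddfD; apply: VD.
  - by rewrite rmorphM; apply: VM.
have primeP p q : P (p * q) -> P p \/ P q.
  by rewrite /P /eval_last rmorphM; case: irrW => _ _; apply.
have relP (f : {mpoly K[N.+1]}) : relation f -> P (muni f).
  by move=> Wf x Wx; rewrite peval_eval_last_muni Wf.
have relC (f : {mpoly K[N]}) : relation f <-> P f%:P.
  by split=> Wf x Wx; have := Wf x Wx; rewrite peval_eval_last map_polyC hornerC.
have nPg : ~ P (muni g).
  by move=> Pg; apply: nWg => x Wx; rewrite -peval_eval_last_muni Pg.
have [h nPh ext] := extend_specialization idP primeP K nPg.
exists h; first by rewrite relC.
move=> a spa ha; have [|b bP gb] := ext (meval (fun i : 'I_N => a i)) _ ha.
  by move=> r /relC; apply: spa.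
pose a' i := if i == N then b else a i.
have a'E (f : {mpoly K[N.+1]}) : f.@[fun i => a' i] =
    (map_poly (meval (fun i : 'I_N => a i)) (muni f)).[b].
  rewrite (@meval_muni _ _ _ _ (fun i : 'I_N => a i)) /a' ?eqxx //=.
  by move=> i; rewrite ltn_eqF.
exists a'; split=> [i iN|f /relP|]; last by rewrite a'E.
  by rewrite /a' ltn_eqF.
by rewrite a'E; apply: bP.
Qed.

Lemma specialization_extend k N (g : {mpoly K[k + N]}) : ~ relation g ->
  exists2 h : {mpoly K[N]}, ~ relation h &
  forall a, specialization N a -> h.@[fun i => a i] != 0 ->
  exists a', [/\ forall i, (i < N)%N -> a' i = a i, specialization (k + N) a' &
    g.@[fun i => a' i] != 0].
Proof.
elim: k g => [|k IHk] g nWg; first by exists g => // a spa ga; exists a.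
have [h nWh exth] := @specialization_step (k + N) g nWg.
have [h' nWh' exth'] := IHk h nWh; exists h' => // a spa /(exth' a spa).
move=> [a1 [a1a spa1 /(exth a1 spa1)[a2 [a2a spa2 ga2]]]].
exists a2; split => // i iN; rewrite a2a ?a1a //.
exact: leq_trans iN (leq_addl _ _).
Qed.

End Specialization.

(* The point above a is a specialization of the functions y_0, ..., y_(m-1),  *)
(* x_0, ..., x_(d-1) on W, in this order.                                     *)
Lemma alg_indep_lift W m y : zirreducible W -> alg_indep W m y ->
  exists2 h : {mpoly K[m]}, h != 0 &
  forall a : nat -> K, h.@[fun i => a i] != 0 ->
  exists2 x, W x & forall i, (i < m)%N -> peval (y i) x = a i.
Proof.
move=> irrW Wy.
pose z i := if (i < m)%N then y i else
  if insub (i - m)%N is Some j then 'X_j else 0.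
have zX (j : 'I_d) : z (m + j)%N = 'X_j.
  by rewrite /z ltnNge leq_addr /= addKn valK.
have relE (P : {mpoly K[m]}) : relation W z P -> P = 0.
  move=> WP; apply: Wy => x Wx; rewrite -[RHS](WP x Wx).
  by apply: meval_eq => i; rewrite /z ltn_ord.
have nW1 : ~ relation W z (1 : {mpoly K[d + m]}).
  have [_ [w Ww] _] := irrW; move=> /(_ w Ww)/eqP.
  by rewrite meval1 oner_eq0.
have [h nWh ext] := specialization_extend irrW nW1.
exists h; first by apply: contra_notN nWh => /eqP -> x _; rewrite meval0.
move=> a ha; have [|a' [a'a spa' _]] := ext a _ ha.
  by move=> P /relE ->; rewrite meval0.
have idx_lt (j : 'I_d) : (m + j < d + m)%N by rewrite addnC ltn_add2r.
pose t := [tuple ('X_(Ordinal (idx_lt j)) : {mpoly K[d + m]}) | j < d].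
have tE (f : {mpoly K[d]}) (v : nat -> K) :
    (f \mPo t).@[fun i => v i] = f.@[fun j : 'I_d => v (m + j)%N].
  by rewrite comp_mpoly_meval; apply: meval_eq => j; rewrite tnth_mktuple mevalXU.
have tz (f : {mpoly K[d]}) x :
    (f \mPo t).@[fun i : 'I_(d + m) => peval (z i) x] = peval f x.
  rewrite (tE f (fun i => peval (z i) x)); apply: meval_eq => j.
  by rewrite zX /peval mevalXU.
pose x : 'rV[K]_d := \row_j a' (m + j)%N.
have xE (f : {mpoly K[d]}) : peval f x = (f \mPo t).@[fun i => a' i].
  by rewrite tE; apply: meval_eq => j; rewrite mxE.
exists x.
  have [cW _ _] := irrW; apply: cW => f Wf; rewrite xE; apply: spa' => u Wu.
  by rewrite tz Wf.
move=> i im; have idm : (i < d + m)%N by apply: leq_trans im (leq_addl _ _).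
have := spa' ('X_(Ordinal idm) - (y i \mPo t)); rewrite mevalB mevalXU /= -xE.
rewrite a'a // => H; apply/esym/eqP; rewrite -subr_eq0; apply/eqP; apply: H => u Wu.
by rewrite mevalB mevalXU tz /= {1}/z im subrr.
Qed.

(** For all but finitely many [c], the polynomial [h] stays nonzero when its last variable is set to
    [c], and the slice then maps onto a set containing a nonempty open part of [K^m]. If every
    component of the slice had a relation, the product of these relations would vanish on that open
    part. *)
Lemma alg_indep_slice W m y : zirreducible W -> alg_indep W m.+1 y ->
  exists cs : seq K, forall c, c \notin cs ->
  exists W', [/\ zirreducible W', W' `<=` W,
    forall x, W' x -> peval (y m) x = c & alg_indep W' m y].
Proof.
move=> irrW Wy; have [h h0 lift] := alg_indep_lift irrW Wy.
have [v hv] : exists v : nat -> K,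
    map_poly (meval (fun i : 'I_m => v i)) (muni h) != 0.
  apply: contrapT => nv; move: h0; rewrite -muni_eq0 => /eqP; apply.
  apply/polyP => k; rewrite coef0; apply: mpoly_eq0_eval => v.
  rewrite -coef_map; apply: contrapT => /eqP hk; apply: nv; exists v.
  by apply: contraNneq hk => ->; rewrite coef0.
have [cs csE] := closed_field_poly_normal
  (map_poly (meval (fun i : 'I_m => v i)) (muni h)).
exists cs => c ncs; pose hc := (muni h).[c%:MP].
have hcE (u : nat -> K) : hc.@[fun i : 'I_m => u i] =
    (map_poly (meval (fun i : 'I_m => u i)) (muni h)).[c].
  by rewrite /hc -horner_map /= mevalC.
have hc0 : hc != 0.
  apply: contraNneq ncs => hc0; have := hcE v; rewrite hc0 meval0 csE hornerZ.
  move=> /esym/eqP; rewrite mulf_eq0 lead_coef_eq0 (negPf hv) /=.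
  by rewrite -[_ == 0]/(root _ c) root_prod_XsubC.
pose X := W `&` [set x | peval (y m - c%:MP) x = 0].
have cX : zclosed X.
  by apply: zclosedI; [case: irrW|apply: zclosed_zeros].
have [Ys YsX cov] := zclosed_components cX.
apply: contrapT => nW'.
have {nW'} dep Y : Y \in Ys -> ~ alg_indep Y m y.
  move=> /YsX[irrY YX] Yy; apply: nW'; exists Y; split => // [x /YX[]//|x /YX[_]].
  by rewrite /= /peval mevalB mevalC => /eqP; rewrite subr_eq0 => /eqP.
have [Q Q0 XQ] : exists2 Q : {mpoly K[m]}, Q != 0 &
    forall Y, Y \in Ys -> forall x, Y x -> Q.@[fun i : 'I_m => peval (y i) x] = 0.
  elim: Ys dep {YsX cov} => [|Y Ys IHYs] dep; first by exists 1; rewrite ?oner_neq0.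
  have [|Q Q0 YsQ] := IHYs; first by move=> Z ZYs; apply: dep; rewrite inE ZYs orbT.
  have /existsNP[P /not_implyP[YP /eqP P0]] := dep Y (mem_head _ _).
  exists (P * Q) => [|Z]; first by rewrite mulf_neq0.
  rewrite inE => /predU1P[->|ZYs] x Zx; rewrite mevalM.
    by rewrite YP // mul0r.
  by rewrite (YsQ Z) // mulr0.
have : Q * hc = 0.
  apply: mpoly_eq0_eval => u; rewrite mevalM.
  have [->|hu] := eqVneq hc.@[fun i => u i] 0; first by rewrite mulr0.
  pose a i := if i == m then c else u i.
  have [|x Wx ya] := lift a.
    rewrite (@meval_muni _ _ _ _ (fun i : 'I_m => u i)) /a /= ?eqxx -?hcE //.
    by move=> i; rewrite ltn_eqF.
  have [|Y YYs Yx] := cov x.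
    by split => //=; rewrite pevalB pevalC ya // /a eqxx subrr.
  rewrite -[RHS](mul0r hc.@[fun i => u i]) -(XQ Y YYs x Yx); congr (_ * _).
  by apply: meval_eq => i; rewrite ya ?leqW // /a ltn_eqF.
by apply/eqP; rewrite mulf_neq0.
Qed.

Lemma alg_indep_zheight W m y : zirreducible W -> alg_indep W m y ->
  zheight_ge m W.
Proof.
elim: m W y => [|m IHm] W y irrW Wy; first exact: zheight0.
have [cs slice] := alg_indep_slice irrW Wy.
have [c /slice[W' [irrW' W'W W'c W'y]]] := closed_notin cs.
apply: zheightS (IHm W' y irrW' W'y) irrW _; split => // WW'.
have X0 : 'X_ord_max - c%:MP = 0 :> {mpoly K[m.+1]}.
  by apply: Wy => x /WW'/W'c; rewrite mevalB mevalXU mevalC /= => ->; rewrite subrr.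
have := congr1 (meval (fun=> 1 + c)) X0.
by rewrite mevalB mevalXU mevalC meval0 addrK => /eqP; rewrite oner_eq0.
Qed.

(** The points [p] and [q] are fixed before [g], so that one [g] can be chosen to separate the pairs
    of finitely many sets. *)
Lemma zheight_slice m W : zheight_ge m.+1 W ->
  exists p q : 'rV[K]_d, [/\ W p, W q, p != q &
    forall g, peval g p != peval g q ->
    exists cs : seq K, forall c, c \notin cs ->
    exists W', [/\ zheight_ge m W', W' `<=` W &
      forall x, W' x -> peval g x = c]].
Proof.
move=> hW; have [p [q [Wp Wq pq sep]]] := zheight_indep hW.
have irrW := zheight_irr hW.
exists p, q; split => // g gpq.
have gE u : peval (g - (peval g p)%:MP) u = peval g u - peval g p.
  by rewrite /peval mevalB mevalC.
have [||y Wy ym] := sep (g - (peval g p)%:MP).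
- by rewrite gE subrr.
- by rewrite gE subr_eq0 eq_sym.
have [cs slice] := alg_indep_slice irrW Wy.
exists [seq c + peval g p | c <- cs] => c ncs.
have [|W' [irrW' W'W W'c W'y]] := slice (c - peval g p).
  apply: contra ncs => ccs; apply/mapP; exists (c - peval g p) => //.
  by rewrite subrK.
exists W'; split => // [|x W'x]; first exact: alg_indep_zheight W'y.
by have := W'c x W'x; rewrite ym gE => /addIr.
Qed.

End Independence.

(** * Finite linear sections *)

Section MomentForm.

Local Open Scope classical_set_scope.

Variables (K : fieldType) (d : nat).

(* The linear forms sum_i t^i x_i: those vanishing at a given nonzero vector  *)
(* are given by the roots t of a nonzero polynomial of degree less than d.    *)
Definition moment_form (t : K) (x : 'rV[K]_d) : K := (rVpoly x).[t].

Lemma moment_formE t x : moment_form t x = \sum_(i < d) x 0 i * t ^+ i.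
Proof.
rewrite /moment_form /rVpoly horner_poly; apply: eq_bigr => i _.
by rewrite valK.
Qed.

Lemma moment_form_is_linear t :
  linear_for *%R (moment_form t : 'rV[K]_d -> K).
Proof. by move=> a x y; rewrite /moment_form linearP hornerD hornerZ. Qed.

HB.instance Definition _ t := GRing.isLinear.Build K 'rV[K]_d K *%R
  (moment_form t) (moment_form_is_linear t).

Definition moment_mpoly (t : K) : {mpoly K[d]} := \sum_(i < d) t ^+ i *: 'X_i.

Lemma peval_moment t x : peval (moment_mpoly t) x = moment_form t x.
Proof.
rewrite /peval /moment_mpoly rmorph_sum moment_formE; apply: eq_bigr => i _ /=.
by rewrite mevalZ mevalXU mulrC.
Qed.

(** The product of the polynomials with coefficient vectors [v]. The bound on its size makes it
    possible to pick [t] in a large finite field. *)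
Lemma moment_separate (vs : seq 'rV[K]_d) : 0 \notin vs ->
  exists2 p : {poly K}, p != 0 /\ (size p <= (size vs * d).+1)%N &
  forall t v, v \in vs -> moment_form t v = 0 -> root p t.
Proof.
elim: vs => [|v vs IHvs]; first by exists 1; rewrite ?oner_neq0 ?size_poly1.
rewrite inE negb_or eq_sym => /andP[v0 /IHvs[p [p0 sp] pE]].
have rv0 : rVpoly v != 0.
  by apply: contraNneq v0 => rv0; rewrite -[v]rVpolyK rv0 linear0.
exists (rVpoly v * p) => [|t w].
  split; first by rewrite mulf_neq0.
  rewrite (leq_trans (size_polyMleq _ _)) // mulSn -addnS.
  have sv : (size (rVpoly v) <= d)%N by apply: size_poly.
  apply: leq_trans (leq_add sv sp); exact: leq_pred.
rewrite inE rootM => /predU1P[->|wvs] w0.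
  by rewrite /root -/(moment_form t v) w0 eqxx.
by rewrite (pE t w) ?orbT.
Qed.

End MomentForm.

Section Affine.

Local Open Scope classical_set_scope.

Variables (K : closedFieldType) (d : nat).

Definition moment_plane (t c : K) : set 'rV[K]_d := [set x | moment_form t x = c].

Lemma zclosed_plane t c : zclosed (moment_plane t c).
Proof.
move=> x Hx; have := Hx (moment_mpoly d t - c%:MP).
rewrite pevalB pevalC peval_moment => H.
apply/eqP; rewrite -subr_eq0; apply/eqP; apply: H => u uc.
by rewrite pevalB pevalC peval_moment uc subrr.
Qed.

Lemma affine_subspace_slice k (L : set 'rV[K]_d) t c (p q : 'rV[K]_d) :
  affine_subspace k.+1 L -> L p -> L q -> moment_form t (p - q) != 0 ->
  affine_subspace k (L `&` moment_plane t c).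
Proof.
move=> [a [U [dU ->]]] /= Lp Lq tpq.
pose f := linfun (moment_form t : 'rV[K]_d -> K^o).
have fE x : f x = moment_form t x by rewrite lfunE.
have Upq : p - q \in U.
  by have := rpredB Lp Lq; rewrite opprB addrA subrK.
(* The point on the line through [a] with direction [p - q] at which the form equals [c]. *)
pose b := a + ((c - moment_form t a) / moment_form t (p - q)) *: (p - q).
have tb : moment_form t b = c by rewrite linearD linearZ /= mulfVK // addrC subrK.
have bU x : (x - b \in U) = (x - a \in U).
  have -> : x - b = (x - a) - (b - a) by rewrite opprB addrA subrK.
  by rewrite rpredBr // /b addrC addKr rpredZ.
exists b, (U :&: lker f)%VS; split.
  have := limg_ker_dim f U; rewrite dU.
  have -> : \dim (f @: U) = 1%N.
    apply/eqP; rewrite eqn_leq; apply/andP; split.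
      by rewrite (leq_trans (dimvS (subvf _))) // dimvf.
    rewrite lt0n dimv_eq0; apply: contraNneq tpq => fU0.
    by have := memv_img f Upq; rewrite fU0 memv0 fE.
  by rewrite addn1 => -[].
apply/seteqP; split => x /=.
  move=> [Lx tx]; rewrite memv_cap bU Lx memv_ker fE linearB /= tb.
  by move: tx; rewrite /moment_plane /= => ->; rewrite subrr eqxx.
rewrite memv_cap bU memv_ker fE linearB /= tb subr_eq0 => /andP[Lx /eqP tx].
by split.
Qed.

Lemma affine_subspace_points k (L : set 'rV[K]_d) : affine_subspace k.+1 L ->
  exists p q, [/\ L p, L q & p - q != 0].
Proof.
move=> [a [U [dU ->]]]; exists (vpick U + a), a => /=.
by rewrite addrK subrr mem0v memv_pick vpick0 -dimv_eq0 dU.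
Qed.

(** Induction on [m], cutting by [moment_plane t c]. The form given by [t] is nonconstant on [L] and
    on each member of [Ws]; avoiding finitely many [c], each member keeps a slice of height [m], the
    dimension of [X] drops, and distinct members keep distinct slices. For [m = 0] the members are
    distinct points of a finite set. *)
Lemma finite_section m (X : set 'rV[K]_d) k (L : set 'rV[K]_d)
    (Ws : seq (set 'rV[K]_d)) :
  zclosed X -> zdim_le X m -> affine_subspace (k + m) L -> X `<=` L ->
  uniq Ws -> (forall W, W \in Ws -> zheight_ge m W /\ W `<=` X) ->
  exists2 M, affine_subspace k M /\ M `<=` L &
  exists s : seq 'rV[K]_d, [/\ uniq s, forall x, (M `&` X) x <-> x \in s &
    (size Ws <= size s)%N].
Proof.
elim: m X L Ws => [|m IHm] X L Ws cX dX affL XL uWs WsX.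
  rewrite addn0 in affL; exists L; first by split.
  have [s us sX] := zdim0_finite cX dX; exists s; split => // [x|].
    by rewrite -sX; split=> [[]//|Xx]; split => //; apply: XL.
  have /choice[pt ptP] : forall W, exists p, W \in Ws -> W = [set p].
    move=> W; have [WWs|nW] := boolP (W \in Ws); last by exists 0.
    have [hW WX] := WsX W WWs; have [_ [p Wp] _] := zheight_irr hW.
    exists p => _; apply/seteqP; split => [|x ->//].
    apply: contrapT => nWp; apply: (dX W) => //.
    apply: zheightS (zheight0 (zirreducible_point p)) (zheight_irr hW) _.
    by split => // x ->.
  rewrite -(size_map pt); apply: uniq_leq_size.
    rewrite map_inj_in_uniq // => U W UWs WWs UW.
    by rewrite (ptP U) // (ptP W) // UW.
  move=> _ /mapP[W WWs ->]; apply/sX; have [_] := WsX W WWs; apply.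
  by suff: [set pt W] (pt W) by rewrite -(ptP W WWs).
rewrite addnS in affL.
have [a [b [La Lb ab]]] := affine_subspace_points affL.
pose slices W (pq : 'rV[K]_d * 'rV[K]_d) t := moment_form t (pq.1 - pq.2) != 0 ->
  exists cs : seq K, forall c, c \notin cs ->
    exists W', [/\ zheight_ge m W', W' `<=` W & W' `<=` moment_plane t c].
have /choice[pq pqP] : forall W, exists pq, W \in Ws ->
    pq.1 - pq.2 != 0 /\ forall t, slices W pq t.
  move=> W; have [WWs|nW] := boolP (W \in Ws); last by exists (0, 0).
  have [hW _] := WsX W WWs; have [p [q [Wp Wq pq sl]]] := zheight_slice hW.
  exists (p, q) => _; split; first by rewrite subr_eq0.
  move=> t /=; rewrite /slices /= linearB /= subr_eq0 -!peval_moment => /sl[cs csP].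
  exists cs => c /csP[W' [hW' W'W W'c]]; exists W'; split => // x /W'c.
  by rewrite peval_moment.
have [t tab tW] : exists2 t, moment_form t (a - b) != 0 &
    forall W, W \in Ws -> moment_form t ((pq W).1 - (pq W).2) != 0.
  have [|p [p0 _] pE] := @moment_separate K d
      (a - b :: [seq (pq W).1 - (pq W).2 | W <- Ws]).
    rewrite inE negb_or eq_sym ab; apply/mapP => -[W WWs /esym/eqP].
    by have [/negPf->] := pqP W WWs.
  have [t nt] := closed_nonroot p0; exists t.
    by apply: contraNneq nt; apply: pE; rewrite mem_head.
  move=> W WWs; apply: contraNneq nt; apply: pE; rewrite inE; apply/orP; right.
  exact: (map_f (fun W => (pq W).1 - (pq W).2)).
have /choice[cs csP] : forall W, exists cs : seq K, W \in Ws ->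
    forall c, c \notin cs ->
    exists W', [/\ zheight_ge m W', W' `<=` W & W' `<=` moment_plane t c].
  move=> W; have [WWs|nW] := boolP (W \in Ws); last by exists [::].
  have [_ /(_ t (tW W WWs))[cs csP]] := pqP W WWs.
  by exists cs => _.
(* Two distinct members meet in dimension at most [m], so only finitely many sets of height [m] can
   be slices of both. *)
have /choice[Us UsP] : forall W : set 'rV[K]_d * set 'rV[K]_d,
    exists Us : seq (set 'rV[K]_d), W.1 \in Ws -> W.2 \in Ws -> W.1 != W.2 ->
    forall U, zheight_ge m U -> U `<=` W.1 `&` W.2 -> U \in Us.
  move=> [W1 W2] /=.
  have [W1Ws|nW] := boolP (W1 \in Ws); last by exists [::].
  have [W2Ws|nW] := boolP (W2 \in Ws); last by exists [::].
  have [eW|W12] := eqVneq W1 W2; first by exists [::].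
  have [hW1 W1X] := WsX W1 W1Ws; have [hW2 W2X] := WsX W2 W2Ws.
  have [||Us _ UsE] := @zheight_finite K d (W1 `&` W2) m.
  - by apply: zclosedI; [case: (zheight_irr hW1)|case: (zheight_irr hW2)].
  - move=> U UW hU; have [W12'|nsub] := pselect (W1 `<=` U).
      have W12s : W1 `<=` W2 by move=> x /W12'/UW[].
      apply: (dX W2) => //; apply: zheightS hW1 (zheight_irr hW2) _.
      split => // W21; case/eqP: W12; exact/seteqP.
    apply: (dX W1) => //; apply: zheightS hU (zheight_irr hW1) _.
    by split => // x /UW[].
  - by exists Us => _ _ _ U hU UW; apply/UsE.
have [Ts _ TsE] := zheight_finite cX dX.
have /choice[pt ptP] : forall U : set 'rV[K]_d, exists x, U !=set0 -> U x.
  move=> U; have [[x Ux]|nU] := pselect (U !=set0); first by exists x.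
  by exists 0.
(* The plane must contain no set of [Ts], or the dimension would not drop, and no common slice from
   [Us]. It suffices that it misses one chosen point of each. *)
pose bad := Ts ++ flatten [seq Us (W1, W2) | W1 <- Ws, W2 <- Ws].
have [c] := closed_notin (flatten [seq cs W | W <- Ws] ++
  [seq moment_form t (pt U) | U <- bad]).
rewrite mem_cat negb_or => /andP[ncs nbad].
have badP U : U \in bad -> U !=set0 -> U `<=` moment_plane t c -> False.
  move=> Ubad /ptP Upt /(_ _ Upt) tc; case/mapP: nbad; exists U => //.
have /choice[sl slP] : forall W, exists W', W \in Ws ->
    [/\ zheight_ge m W', W' `<=` W & W' `<=` moment_plane t c].
  move=> W; have [WWs|nW] := boolP (W \in Ws); last by exists set0.
  have [|W' W'P] := csP W WWs c; last by exists W'.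
  by apply: contra ncs => ccs; apply/flattenP; exists (cs W) => //; apply: map_f.
have [||||||M [affM ML] [s [us sE sWs]]] :=
    IHm (X `&` moment_plane t c) (L `&` moment_plane t c) [seq sl W | W <- Ws].
- by apply: zclosedI => //; apply: zclosed_plane.
- move=> U UX hU; have [_ U0 _] := zheight_irr hU.
  apply: (badP U) => // [|x /UX[]//].
  by rewrite mem_cat; apply/orP; left; apply/TsE; split => // x /UX[].
- exact: affine_subspace_slice affL La Lb tab.
- by move=> x [Xx tx]; split => //; apply: XL.
- rewrite map_inj_in_uniq // => W1 W2 W1Ws W2Ws eqW; apply/eqP/negPn/negP => W12.
  have [h1 sW1 s1] := slP W1 W1Ws; have [_ sW2 _] := slP W2 W2Ws.
  have [_ U0 _] := zheight_irr h1.
  apply: (badP (sl W1)) => //; rewrite mem_cat; apply/orP; right.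
  apply/flattenP; exists (Us (W1, W2)).
    by apply/allpairsP; exists (W1, W2).
  by apply: UsP => // x Ux; split; [exact: sW1|apply: sW2; rewrite -eqW].
- move=> _ /mapP[W WWs ->]; have [hsl sW st] := slP W WWs; split => // x slx.
  by split; [have [_] := WsX W WWs; apply; apply: sW|apply: st].
exists M; first by split => // x /ML[].
exists s; split => // [x|]; last by rewrite size_map in sWs.
rewrite -sE; split=> [[Mx Xx]|[Mx [Xx _]]] //; split => //; split => //.
by have [] := ML x Mx.
Qed.

End Affine.

(** * Chains of varieties over the finite field *)

Lemma meval_map_mpoly (n : nat) (R S : comNzRingType) (f : {rmorphism R -> S})
    (p : {mpoly R[n]}) (v : 'I_n -> R) :
  (map_mpoly f p).@[fun i => f (v i)] = f p.@[v].
Proof.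
rewrite [in RHS]mevalE rmorph_sum /map_mpoly /mmap rmorph_sum /=; apply: eq_bigr => m _.
rewrite mevalM mevalC mmap1_id mevalX rmorphM rmorph_prod /=.
by congr (_ * _); apply: eq_bigr => i _; rewrite rmorphXn.
Qed.

Section Closure.

Local Open Scope classical_set_scope.

Variables (F : finFieldType) (K : closedFieldType) (iota : {rmorphism F -> K}).
Variable d : nat.
Implicit Types (Y V : set 'rV[K]_d).

(** The closure of [Y] in the topology whose closed sets are the varieties defined over [F]. *)
Definition rational_closure Y : set 'rV[K]_d :=
  [set x | forall f : {mpoly F[d]}, vanishing Y (map_mpoly iota f) ->
    peval (map_mpoly iota f) x = 0].

Lemma sub_rational_closure Y : Y `<=` rational_closure Y.
Proof. by move=> x Yx f; apply. Qed.

Lemma variety_zclosed V : variety iota V -> zclosed V.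
Proof. by move=> [s ->] x Vx f fs; apply: Vx => u; apply. Qed.

Lemma rational_closure_min V Y : variety iota V -> Y `<=` V ->
  rational_closure Y `<=` V.
Proof. by move=> [s ->] YV x Yx f fs; apply: Yx => u /YV; apply. Qed.

Lemma rational_closure_variety Y : variety iota (rational_closure Y).
Proof.
have idI (Z : set 'rV[K]_d) :
    is_ideal (fun f : {mpoly F[d]} => vanishing Z (map_mpoly iota f)).
  have [V0 VD VM] := vanishing_ideal Z; split => [|f g Zf Zg|f g Zg].
  - by rewrite raddf0.
  - by rewrite raddfD; apply: VD.
  - by rewrite rmorphM; apply: VM.
have [s sI sgen] := noetherian_mpoly (idI Y).
exists s; apply/seteqP; split => [x Yx f fs|x sx f Yf].
  exact: Yx (sI f fs).
have := sgen _ (idI [set x]) _ f Yf; apply => // g gs _ ->; exact: sx.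
Qed.

Lemma rational_closure_irreducible Y : zirreducible Y ->
  irreducible_variety iota (rational_closure Y).
Proof.
move=> irrY; have [_ [y Yy] _] := irrY; split.
- exact: rational_closure_variety.
- by exists y; apply: sub_rational_closure.
move=> A B vA vB YAB.
have [||C] := @zirreducible_cover K d Y [:: A; B] irrY.
- by move=> C; rewrite !inE => /orP[] /eqP->; apply: variety_zclosed.
- move=> x /sub_rational_closure; rewrite YAB => -[Ax|Bx]; [exists A|exists B];
  by rewrite ?inE ?eqxx ?orbT.
rewrite !inE => /orP[] /eqP-> YC; [left|right]; apply/seteqP; split.
- exact: rational_closure_min.
- by rewrite YAB => x Ax; left.
- exact: rational_closure_min.
- by rewrite YAB => x Bx; right.
Qed.

(** * Frobenius action on points and equations, and descent to [F] *)

Definition frob (i : nat) (x : K) : K := x ^+ (#|F| ^ i).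

Lemma frob_is_zmod_morphism i : zmod_morphism (frob i).
Proof.
move=> x y; rewrite /frob; have [p p_pr pF] := finPcharP F.
have qE : [pchar K].-nat (#|F| ^ i)%N.
  have -> : #|F| = (p ^ logn p #|F|)%N := card_pprimeChar pF.
  by rewrite -expnM pnatX pnatE // (fmorph_pchar iota) pF.
by rewrite -{2}[x](subrK y) [in RHS]exprDn_pchar // addrK.
Qed.

Lemma frob_is_monoid_morphism i : monoid_morphism (frob i).
Proof. by split=> [|x y]; rewrite /frob ?exprMn ?expr1n. Qed.

HB.instance Definition _ i :=
  GRing.isZmodMorphism.Build K K (frob i) (frob_is_zmod_morphism i).
HB.instance Definition _ i :=
  GRing.isMonoidMorphism.Build K K (frob i) (frob_is_monoid_morphism i).

Lemma frob0 x : frob 0 x = x.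
Proof. by rewrite /frob expn0 expr1. Qed.

Lemma frobD i j x : frob (i + j) x = frob i (frob j x).
Proof. by rewrite /frob -exprM -expnD addnC. Qed.

Lemma frob_iota i a : frob i (iota a) = iota a.
Proof.
elim: i => [|i IHi]; first exact: frob0.
by rewrite -addn1 frobD {2}/frob expn1 -rmorphXn expf_card.
Qed.

Lemma frob_mul_period k r x : frob r x = x -> frob (k * r) x = x.
Proof.
move=> rx; elim: k => [|k IHk]; first exact: frob0.
by rewrite mulSn frobD IHk.
Qed.

Lemma frob_fixed x : frob 1 x = x -> exists a, x = iota a.
Proof.
rewrite /frob expn1 => xq; have := congr1 (map_poly iota) (finField_genPoly F).
rewrite rmorphB rmorphXn rmorph_prod /= map_polyX => /(congr1 (horner^~ x)).
rewrite hornerD hornerN hornerXn hornerX xq subrr horner_prod => /esym/eqP.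
move=> /prodf_eq0[a _]; rewrite rmorphB /= map_polyX map_polyC hornerXsubC.
by rewrite subr_eq0 => /eqP ->; exists a.
Qed.

Hypothesis iota_int : integralRange iota.

(** The conjugates of [x] are roots of one nonzero polynomial over [F], so two of them coincide;
    injectivity of [frob] cancels the smaller exponent. *)
Lemma frob_period x : exists2 r, (0 < r)%N & frob r x = x.
Proof.
have [p p_mon px] := iota_int x; pose pK := map_poly iota p.
pose s := mkseq (frob^~ x) (size pK).
have pK0 : pK != 0 by rewrite map_poly_eq0 monic_neq0.
have s_roots : all (root pK) s.
  apply/allP => _ /mapP[i _ ->].
  have <- : map_poly (frob i) pK = pK.
    by rewrite -map_poly_comp; apply: eq_map_poly => a /=; apply: frob_iota.
  by rewrite /root horner_map (eqP px) rmorph0.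
have /(uniqPn 0)[i [j [ij jp]]] : ~~ uniq s.
  by apply/negP => /(max_poly_roots pK0 s_roots); rewrite size_mkseq ltnn.
rewrite size_mkseq in jp; rewrite !nth_mkseq //; last exact: ltn_trans jp.
rewrite -{1}(subnKC (ltnW ij)) frobD => /fmorph_inj ijx.
by exists (j - i)%N; rewrite ?subn_gt0.
Qed.

Lemma frob_common_period (s : seq K) :
  exists2 r, (0 < r)%N & forall x, x \in s -> frob r x = x.
Proof.
elim: s => [|x s [r r0 rs]]; first by exists 1%N.
have [k k0 kx] := frob_period x; exists (k * r)%N; first by rewrite muln_gt0 k0.
move=> y; rewrite inE => /predU1P[->|/rs]; last exact: frob_mul_period.
by rewrite mulnC; apply: frob_mul_period.
Qed.

Definition frob_pt (i : nat) (x : 'rV[K]_d) : 'rV[K]_d := map_mx (frob i) x.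

Lemma frob_ptD i j x : frob_pt (i + j) x = frob_pt i (frob_pt j x).
Proof. by apply/rowP => k; rewrite !mxE frobD. Qed.

Lemma frob_pt_period x : exists2 r, (0 < r)%N & frob_pt r x = x.
Proof.
have [r r0 rx] := frob_common_period [seq x 0 i | i <- enum 'I_d].
exists r => //; apply/rowP => i; rewrite mxE rx //.
by apply: map_f; rewrite mem_enum.
Qed.

Lemma peval_frob i f x :
  peval (map_mpoly (frob i) f) (frob_pt i x) = frob i (peval f x).
Proof.
rewrite /peval -meval_map_mpoly; apply: meval_eq => k.
by rewrite mxE.
Qed.

Lemma mpoly_period (f : {mpoly K[d]}) :
  exists2 r, (0 < r)%N & map_mpoly (frob r) f = f.
Proof.
have [r r0 rf] := frob_common_period [seq f@_m | m <- msupp f].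
exists r => //; apply/mpolyP => m; rewrite mcoeff_map_mpoly.
have [mf|/memN_msupp_eq0->] := boolP (m \in msupp f); last exact: rmorph0.
by apply: rf; apply: map_f.
Qed.

Lemma mpoly_descent (g : {mpoly K[d]}) : map_mpoly (frob 1) g = g ->
  exists g0, map_mpoly iota g0 = g.
Proof.
move=> gE; have /choice[b bE] : forall m, exists a, g@_m = iota a.
  by move=> m; apply: frob_fixed; rewrite -mcoeff_map_mpoly gE.
exists (\sum_(m <- msupp g) b m *: 'X_[m]).
rewrite rmorph_sum [RHS]mpolyE; apply: eq_bigr => m _ /=.
by rewrite map_mpolyZ map_mpolyX bE.
Qed.

(** A common period of the coefficients of finitely many equations for [Y] works. *)
Lemma frob_zperiod Y : zclosed Y ->
  exists2 r, (0 < r)%N & forall x, Y (frob_pt r x) <-> Y x.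
Proof.
move=> cY; have [fs fsY fsgen] := noetherian_mpoly (vanishing_ideal Y).
have YE x : Y x <-> forall f, f \in fs -> peval f x = 0.
  split=> [Yx f /fsY|fsx]; first exact.
  apply: cY => f Yf; have := fsgen _ (vanishing_ideal [set x]) _ f Yf.
  by apply=> // g /fsx gx _ ->.
have [r r0 rfs] : exists2 r, (0 < r)%N &
    forall f, f \in fs -> map_mpoly (frob r) f = f.
  have [r r0 rP] := frob_common_period
    (flatten [seq [seq f@_m | m <- msupp f] | f <- fs]).
  exists r => // f fs_f; apply/mpolyP => m; rewrite mcoeff_map_mpoly.
  have [mf|/memN_msupp_eq0->] := boolP (m \in msupp f); last exact: rmorph0.
  by apply: rP; apply/flattenP; exists [seq f@_m | m <- msupp f]; apply: map_f.
exists r => // x; rewrite !YE; split=> H f fs_f; have := H f fs_f.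
  rewrite -{1}(rfs f fs_f) peval_frob => /eqP; rewrite fmorph_eq0.
  by move=> /eqP.
by move=> fx; rewrite -(rfs f fs_f) peval_frob fx rmorph0.
Qed.

Lemma zclosed_frob i Y : zclosed Y -> zclosed [set x | Y (frob_pt i x)].
Proof.
move=> cY x Hx /=; apply: cY => f Yf.
pose t := [tuple ('X_j ^+ (#|F| ^ i) : {mpoly K[d]}) | j < d].
have tE u : peval (f \mPo t) u = peval f (frob_pt i u).
  rewrite /peval comp_mpoly_meval; apply: meval_eq => j.
  by rewrite tnth_mktuple rmorphXn /= mevalXU mxE.
by rewrite -tE; apply: Hx => u Yu; rewrite tE; apply: Yf.
Qed.

Lemma zclosedU Y Z : zclosed Y -> zclosed Z -> zclosed (Y `|` Z).
Proof.
move=> cY cZ x Hx; apply: contrapT => /not_orP[nYx nZx].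
have sep (A : set 'rV[K]_d) : zclosed A -> ~ A x ->
    exists2 f, vanishing A f & peval f x != 0.
  move=> cA nAx; have [|f Af] := @not_subset K d [set x] A cA.
    by move=> /(_ x erefl).
  by move=> /not_vanishing[_ -> fx]; exists f.
have [f Yf fx] := sep Y cY nYx; have [g Zg gx] := sep Z cZ nZx.
have : peval (f * g) x = 0.
  by apply: Hx => u [/Yf|/Zg] e; rewrite pevalM e ?mul0r ?mulr0.
by rewrite pevalM => /eqP; rewrite mulf_eq0 (negPf fx) (negPf gx).
Qed.

(* If f vanishes on the union of the Frobenius conjugates of Y, so do the     *)
(* lower coefficients of the product of the T - f^(sigma^i), which are        *)
(* defined over F.                                                            *)
Lemma rational_closure_sub_orbit Y r : zclosed Y -> (0 < r)%N ->
  (forall x, Y (frob_pt r x) <-> Y x) ->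
  rational_closure Y `<=` [set x | exists2 i, (i < r)%N & Y (frob_pt i x)].
Proof.
move=> cY r0 rY; set G := [set x | _].
have Yk k x : Y (frob_pt (k * r) x) <-> Y x.
  elim: k x => [|k IHk] x.
    have -> // : frob_pt (0 * r) x = x by apply/rowP => j; rewrite mxE frob0.
  by rewrite mulSn frob_ptD rY.
have YG i x : Y (frob_pt i x) -> G x.
  rewrite {1}(divn_eq i r) frob_ptD Yk => Yi; exists (i %% r)%N => //.
  by rewrite ltn_mod.
have Gfrob i x : G x -> G (frob_pt i x).
  move=> [j _ Yj]; apply: (YG (i * r + j - i)%N).
  have le : (i <= i * r + j)%N by rewrite (leq_trans _ (leq_addr _ _)) // leq_pmulr.
  by rewrite -frob_ptD subnK // frob_ptD Yk.
have cG : zclosed G.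
  suff : forall k, zclosed [set x | exists2 i, (i < k)%N & Y (frob_pt i x)].
    by apply.
  elim=> [|k IHk].
    move=> x Hx; have /eqP : peval (1 : {mpoly K[d]}) x = 0 by apply: Hx => u [].
    by rewrite /peval meval1 oner_eq0.
  suff -> : [set x | exists2 i, (i < k.+1)%N & Y (frob_pt i x)] =
      [set x | exists2 i, (i < k)%N & Y (frob_pt i x)] `|` [set x | Y (frob_pt k x)].
    by apply: zclosedU => //; apply: zclosed_frob.
  apply/seteqP; split=> x /=; last first.
    by move=> [[i ik Yi]|Yk']; [exists i; rewrite // ltnW|exists k].
  move=> [i]; rewrite ltnS leq_eqVlt => /predU1P[->|ik] Yi; first by right.
  by left; exists i.
move=> z Yz; apply: cG => f Gf.
have [s s0 sf] := mpoly_period f.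
have frobf0 : map_mpoly (frob 0) f = f.
  by apply/mpolyP => m; rewrite mcoeff_map_mpoly; apply: frob0.
have Gfi i : vanishing G (map_mpoly (frob i) f).
  move=> x Gx; have [k k0 kx] := frob_pt_period x.
  (* As [frob_pt k] fixes [x], so does [frob_pt (k * i)]; hence [x'] is the preimage of [x] under
     [frob_pt i]. *)
  pose x' := frob_pt (k * i - i)%N x.
  have -> : x = frob_pt i x'.
    rewrite -frob_ptD subnKC ?leq_pmull //; elim: i {x'} => [|i IHi].
      by apply/rowP => j; rewrite mxE muln0 frob0.
    by rewrite mulnS frob_ptD -IHi.
  by rewrite peval_frob Gf ?rmorph0 //; apply: Gfrob.
pose P := \prod_(i < s) ('X - (map_mpoly (frob i) f)%:P).
have Peval (x : 'rV[K]_d) : map_poly (meval (fun j : 'I_d => x 0 j)) P =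
    \prod_(i < s) ('X - (peval (map_mpoly (frob i) f) x)%:P).
  rewrite rmorph_prod; apply: eq_bigr => i _.
  by rewrite rmorphB /= map_polyX map_polyC.
have Pfix : map_poly (map_mpoly (frob 1)) P = P.
  have frobS i : map_mpoly (frob 1) (map_mpoly (frob i) f) = map_mpoly (frob i.+1) f.
    by apply/mpolyP => m; rewrite !mcoeff_map_mpoly; apply/esym/(frobD 1 i).
  rewrite rmorph_prod /P; case: s s0 sf @P Peval => // s _ sf _ _.
  rewrite big_ord_recr [RHS]big_ord_recl [LHS]mulrC /=; congr (_ * _).
    by rewrite rmorphB /= map_polyX map_polyC /= frobS sf frobf0.
  by apply: eq_bigr => i _; rewrite rmorphB /= map_polyX map_polyC /= frobS.
have sP : size P = s.+1.
  rewrite /P size_prod_XsubC /index_enum; case: index_enum_key => /=.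
  by rewrite -enumT size_enum_ord.
have Pcoef k : peval P`_k z = ('X^s : {poly K})`_k.
  rewrite coefXn; have [ks|sk|->] := ltngtP k s.
  - have [g gE] : exists g, map_mpoly iota g = P`_k.
      by apply: mpoly_descent; rewrite -coef_map Pfix.
    rewrite -gE; apply: Yz => y Yy; rewrite gE.
    have -> : peval P`_k y = (map_poly (meval (fun j : 'I_d => y 0 j)) P)`_k.
      by rewrite coef_map.
    rewrite Peval (eq_bigr (fun=> 'X)) ?prodr_const ?card_ord ?coefXn ?ltn_eqF //.
    move=> i _; rewrite Gfi ?subr0 //.
    apply: (YG 0%N); rewrite [frob_pt _ _](_ : _ = y) //.
    by apply/rowP => j; rewrite mxE frob0.
  - by rewrite nth_default ?sP // /peval meval0.
  - have Pm : P \is monic by apply: monic_prod_XsubC.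
    have := monicP Pm; rewrite /lead_coef sP /= => ->.
    by rewrite /peval meval1.
have PzE : map_poly (meval (fun j : 'I_d => z 0 j)) P = 'X^s.
  by apply/polyP => k; rewrite coef_map; apply: Pcoef.
have := congr1 (horner^~ (peval f z)) PzE; rewrite Peval hornerXn horner_prod.
have -> : \prod_(i < s) ('X - (peval (map_mpoly (frob i) f) z)%:P).[peval f z] = 0.
  rewrite (bigD1 (Ordinal s0)) //= hornerXsubC.
  by rewrite frobf0 subrr mul0r.
by move=> /esym/eqP; rewrite expf_eq0 => /andP[_ /eqP].
Qed.

(** If the closures agreed, [Y'] would be covered by finitely many Frobenius preimages of [Y] and so
    lie in one of them. Iterating that inclusion [r] times, for a period [r] of [Y], would put [Y']
    inside [Y]. *)
Lemma rational_closure_proper Y Y' : zirreducible Y -> zirreducible Y' ->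
  Y `<` Y' -> rational_closure Y `<` rational_closure Y'.
Proof.
move=> irrY irrY' [YY' nY'Y]; split.
  by move=> x Yx f Y'f; apply: Yx; apply: vanishing_sub Y'f.
move=> closY'; have [cY _ _] := irrY.
have [r r0 rY] := frob_zperiod cY.
have [||_ /mapP[i _ ->] Y'i] := @zirreducible_cover K d Y'
    [seq [set x | Y (frob_pt i x)] | i <- seq.iota 0 r] irrY'.
- by move=> _ /mapP[i _ ->]; apply: zclosed_frob.
- move=> x /sub_rational_closure /closY'.
  move=> /(rational_closure_sub_orbit cY r0 rY)[i ir Yi].
  exists [set x | Y (frob_pt i x)] => //.
  by apply: (map_f (fun i => [set x | Y (frob_pt i x)])); rewrite mem_iota.
apply: nY'Y => x Y'x; have Yi k : Y (frob_pt (k.+1 * i) x).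
  elim: k => [|k IHk]; first by rewrite mul1n; apply: Y'i.
  by rewrite mulSn frob_ptD; apply: Y'i; apply: YY'.
have Yk k u : Y (frob_pt (k * r) u) <-> Y u.
  elim: k u => [|k IHk] u.
    have -> // : frob_pt (0 * r) u = u by apply/rowP => j; rewrite mxE frob0.
  by rewrite mulSn frob_ptD rY.
by have := Yi r.-1; rewrite prednK // mulnC Yk.
Qed.

Lemma zheight_chain m W : zheight_ge m W ->
  exists X : nat -> set 'rV[K]_d,
    [/\ forall j, (j <= m)%N -> irreducible_variety iota (X j) /\
          X j `<=` rational_closure W,
        forall j, (j < m)%N -> X j `<` X j.+1 & X m = rational_closure W].
Proof.
elim=> {m W} [W irrW|m U W hU [X [Xirr Xlt Xm]] irrW UW].
  exists (fun=> rational_closure W); split => // j _.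
  by split => //; apply: rational_closure_irreducible.
have lt_closure := rational_closure_proper (zheight_irr hU) irrW UW.
exists (fun j => if (j <= m)%N then X j else rational_closure W).
split=> [j _|j|]; last by rewrite ltnn.
  case: ifP => [jm|_]; last first.
    by split => //; apply: rational_closure_irreducible.
  have [irrX XU] := Xirr j jm; split => // x /XU.
  by case: lt_closure => sub _; apply: sub.
rewrite ltnS => jm; rewrite jm; case: ltnP => [jm'|mj]; first exact: Xlt.
by have -> : j = m; [apply/eqP; rewrite eqn_leq jm|rewrite Xm].
Qed.

(** Rational closures turn a chain over [K] into one over [F] of the same length, so the dimension
    over [F] bounds heights over [K]. *)
Lemma zdim_le_variety V n : variety iota V ->
  (forall m, has_chain iota V m -> (m <= n)%N) -> zdim_le V n.
Proof.
move=> vV maxn W WV hW; have [X [Xirr Xlt Xm]] := zheight_chain hW.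
suff /maxn : has_chain iota V n.+1 by rewrite ltnn.
exists X; split => // j jn; have [irrX XW] := Xirr j jn; split => // x /XW.
exact: rational_closure_min.
Qed.

End Closure.

(** * Counting rational points *)

Section Count.

Local Open Scope classical_set_scope.

Lemma card_eq_seq (T : eqType) (s : seq T) : uniq s ->
  ([set x | x \in s] #= `I_(size s))%card.
Proof.
elim: s => [_|x s IHs /= /andP[nxs us]].
  have -> : [set x : T | x \in [::]] = set0 by apply/seteqP; split.
  by rewrite II0 card_eq0.
apply/eq_cardSP; exists x; first by rewrite /= mem_head.
suff -> : [set y | y \in x :: s] `\ x = [set y | y \in s] by exact: IHs.
apply/seteqP; split=> y /=.
  by move=> []; rewrite inE => /predU1P[->|].
move=> ys; split; first by rewrite inE ys orbT.
by move=> yx; rewrite -yx ys in nxs.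
Qed.

Variables (F : finFieldType) (K : closedFieldType) (iota : {rmorphism F -> K}).
Variables (d n D : nat) (V : set 'rV[K]_d).
Hypothesis cV : zclosed V.
Hypothesis sectionV : forall N, finite_section_sizes V n N -> (N <= D)%N.
Hypothesis largeF : (D.+1 * d < #|F|)%N.

Lemma section_size k (M : set 'rV[K]_d) (s : seq 'rV[K]_d) :
  (k + n)%N = d -> affine_subspace k M -> uniq s ->
  (forall x, (M `&` V) x <-> x \in s) -> (size s <= D)%N.
Proof.
move=> kn affM us sE; apply: sectionV; exists k, M; split => //.
suff -> : M `&` V = [set x | x \in s] by exact: card_eq_seq.
by apply/seteqP; split=> x /sE.
Qed.

Lemma moment_form_iota t (x : 'rV[F]_d) :
  moment_form (iota t) (map_mx iota x) = iota (moment_form t x).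
Proof. by rewrite /moment_form -map_rVpoly horner_map. Qed.

Lemma mem_rational_points (X : set 'rV[K]_d) x :
  (x \in rational_points iota X) = `[< X (map_mx iota x) >].
Proof. by rewrite inE. Qed.

(** The codimension [n] of the final section stays fixed: [L] and [m] shrink together until [L]
    itself is a section counted by [D]. In each step at most [D] top-dimensional sets occur, and a
    form over [F] that is constant on none of them splits the rational points into [#|F|] slices of
    smaller dimension. *)
Lemma card_rational_section m k (L : set 'rV[K]_d) :
  (k + n)%N = d -> affine_subspace (k + m) L ->
  zclosed (L `&` V) -> zdim_le (L `&` V) m ->
  (#|rational_points iota (L `&` V)| <= D * #|F| ^ m)%N.
Proof.
move=> kn; elim: m L => [|m IHm] L affL cX dX.
  rewrite addn0 in affL; have [s us sE] := zdim0_finite cX dX.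
  rewrite expn0 muln1; apply: leq_trans (section_size kn affL us sE).
  rewrite cardE -(size_map (map_mx iota)); apply: uniq_leq_size.
    rewrite map_inj_uniq ?enum_uniq // => x y /rowP xy.
    by apply/rowP => i; have := xy i; rewrite !mxE => /fmorph_inj.
  by move=> _ /mapP[x + ->]; rewrite mem_enum mem_rational_points => /asboolP/sE.
have [Ws uWs WsE] := zheight_finite cX dX.
have sWs : (size Ws <= D)%N.
  have [|M [affM ML] [s [us sE sWs]]] :=
    finite_section cX dX affL (@subIsetl _ L V) uWs.
    by move=> W /WsE.
  apply: leq_trans sWs (section_size kn affM us _) => x.
  rewrite -sE; split=> [[Mx Vx]|[Mx [Lx Vx]]] //.
  by split => //; split => //; apply: ML.
rewrite addnS in affL.
have [a [b [La Lb ab]]] := affine_subspace_points affL.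
have /choice[pq pqP] : forall W, exists pq : 'rV[K]_d * 'rV[K]_d, W \in Ws ->
    [/\ W pq.1, W pq.2 & pq.1 - pq.2 != 0].
  move=> W; have [/WsE[hW _]|nW] := boolP (W \in Ws); last by exists (0, 0).
  have [p [q [Wp Wq pq _]]] := zheight_slice hW.
  by exists (p, q); split; rewrite ?subr_eq0.
have [|p [p0 sp] pE] := @moment_separate K d
    (a - b :: [seq (pq W).1 - (pq W).2 | W <- Ws]).
  rewrite inE negb_or eq_sym ab; apply/mapP => -[W WWs /esym/eqP].
  by have [_ _ /negPf->] := pqP W WWs.
(* The polynomial [p] has degree at most [(D + 1) d]: one vector for each of at most [D] sets, and
   one for [L]. *)
have [t nt] : exists t, ~~ root p (iota t).
  apply/existsP; rewrite -negb_forall; apply/negP => /forallP all_root.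
  have := @max_poly_roots _ p [seq iota t | t <- enum F] p0.
  rewrite map_inj_uniq ?enum_uniq; last exact: fmorph_inj.
  have -> : all (root p) [seq iota t | t <- enum F].
    by apply/allP => _ /mapP[t _ ->]; apply: all_root.
  move=> /(_ isT isT); rewrite size_map -cardE; apply/negP; rewrite -leqNgt.
  apply: leq_trans sp _; apply: leq_ltn_trans largeF.
  by rewrite leq_mul2r /= size_map ltnS sWs orbT.
have tab : moment_form (iota t) (a - b) != 0.
  by apply: contraNneq nt; apply: pE; rewrite mem_head.
have tW W : W \in Ws ->
    moment_form (iota t) ((pq W).1 - (pq W).2) != 0.
  move=> WWs; apply: contraNneq nt; apply: pE; rewrite inE; apply/orP; right.
  exact: (map_f (fun W => (pq W).1 - (pq W).2)).
pose slice u := L `&` moment_plane (iota t) (iota u).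
have sliceE u : slice u `&` V = (L `&` V) `&` moment_plane (iota t) (iota u).
  by rewrite /slice setIAC.
have IHslice u : (#|rational_points iota (slice u `&` V)| <= D * #|F| ^ m)%N.
  apply: IHm; first exact: affine_subspace_slice affL La Lb tab.
    by rewrite sliceE; apply: zclosedI => //; apply: zclosed_plane.
  move=> W; rewrite sliceE => WX hW.
  have WWs : W \in Ws by apply/WsE; split => // x /WX[].
  have [Wp Wq _] := pqP W WWs; move: (tW W WWs); rewrite linearB /=.
  by move: (WX _ Wp) (WX _ Wq) => [_ ->] [_ ->]; rewrite subrr eqxx.
rewrite expnS mulnCA -sum1_card (partition_big (moment_form t) xpredT) //=.
rewrite -sum_nat_const; apply: leq_sum => u _.
apply: leq_trans (IHslice u); rewrite sum1_card; apply: subset_leq_card.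
apply/fintype.subsetP => x.
rewrite [x \in rational_points _ (slice _ `&` _)]mem_rational_points.
rewrite unfold_in => /andP[]; rewrite mem_rational_points => /asboolP[Lx Vx] /eqP xu.
apply/asboolP; split => //; split => //.
by rewrite /moment_plane /= moment_form_iota xu.
Qed.

Lemma card_rational_points : (n <= d)%N -> zdim_le V n ->
  (#|rational_points iota V| <= D * #|F| ^ n)%N.
Proof.
move=> nd dV; rewrite -[V]setTI.
apply: (@card_rational_section n (d - n)); rewrite ?setTI ?subnK //.
exists 0, {:'rV[K]_d}%VS; split; first by rewrite dimvf /dim /= mul1n.
by apply/seteqP; split => // x _ /=; rewrite memvf.
Qed.

End Count.

(** * Incidences and distances *)

(** Cauchy-Schwarz, from summing [2 x y <= x^2 + y^2] over all pairs. *)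
Lemma sqr_sum_le (R : realFieldType) (I : finType) (A : {set I}) (x : I -> R) :
  (\sum_(i in A) x i) ^+ 2 <= #|A|%:R * \sum_(i in A) x i ^+ 2.
Proof.
have le2 : \sum_(i in A) \sum_(j in A) (2 * (x i * x j)) <=
    \sum_(i in A) \sum_(j in A) (x i ^+ 2 + x j ^+ 2).
  apply: ler_sum => i _; apply: ler_sum => j _.
  have := sqr_ge0 (x i - x j); lra.
have E1 : \sum_(i in A) \sum_(j in A) (2 * (x i * x j)) =
    2 * (\sum_(i in A) x i) ^+ 2.
  rewrite expr2 big_distrlr /= mulr_sumr; apply: eq_bigr => i _.
  by rewrite mulr_sumr.
have E2 : \sum_(i in A) \sum_(j in A) (x i ^+ 2 + x j ^+ 2) =
    2 * (#|A|%:R * \sum_(i in A) x i ^+ 2).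
  rewrite (eq_bigr (fun i => #|A|%:R * x i ^+ 2 + \sum_(j in A) x j ^+ 2)).
    by rewrite big_split /= -mulr_sumr sumr_const -[_ *+ #|A|]mulr_natl; ring.
  by move=> i _; rewrite big_split /= sumr_const -[_ *+ #|A|]mulr_natl.
by move: le2; rewrite E1 E2; lra.
Qed.

Section Incidence.

Variables (F : finFieldType) (m : nat).
Implicit Types (p v : 'rV[F]_m).

Definition dot v p : F := \sum_i v 0 i * p 0 i.

Lemma dotDr v p u : dot v (p + u) = dot v p + dot v u.
Proof. by rewrite /dot -big_split; apply: eq_bigr => i _; rewrite mxE mulrDr. Qed.

Lemma dotBl v w p : dot (v - w) p = dot v p - dot w p.
Proof. by rewrite /dot -sumrB; apply: eq_bigr => i _; rewrite !mxE mulrBl. Qed.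

Lemma card_hyperplane v c : v != 0 ->
  (#|F| * #|[set p | dot v p == c]| = #|F| ^ m)%N.
Proof.
move=> v0; have [i vi] : exists i, v 0 i != 0.
  apply/existsP; rewrite -negb_forall; apply: contra v0 => /forallP vE.
  by apply/eqP/rowP => i; rewrite mxE; apply/eqP/vE.
pose e t : 'rV[F]_m := \row_j (t * (j == i)%:R).
have dote t : dot v (e t) = v 0 i * t.
  rewrite /dot (bigD1 i) //= big1 ?addr0; first by rewrite mxE eqxx mulr1.
  by move=> j /negPf ji; rewrite mxE ji !mulr0.
have le c1 c2 : (#|[set p | dot v p == c1]| <= #|[set p | dot v p == c2]|)%N.
  rewrite -(card_imset _ (@addIr _ (e ((c2 - c1) / v 0 i)))).
  apply: subset_leq_card; apply/fintype.subsetP => _ /imsetP[p + ->].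
  rewrite !inE => /eqP pc1; rewrite dotDr dote pc1 mulrCA mulfV // mulr1.
  by rewrite addrC subrK.
have <- : (\sum_(b : F) #|[set p | dot v p == b]| = #|F| ^ m)%N.
  transitivity #|{: 'rV[F]_m}|; last by rewrite card_mx mul1n.
  rewrite -sum1_card (partition_big (dot v) xpredT) //=.
  by apply: eq_bigr => b _; rewrite -sum1_card; apply: eq_bigl => p; rewrite inE.
rewrite -sum_nat_const; apply: eq_bigr => b _.
by apply/eqP; rewrite eqn_leq !le.
Qed.

Variables (I J : finType) (A : {set I}) (B : {set J}).
Variables (vec : I -> 'rV[F]_m) (pt : J -> 'rV[F]_m) (s : I -> F) (r : J -> F).
Hypotheses (vec_inj : injective vec) (pt_inj : injective pt).

(** Each [i] stands for a hyperplane of [F^(m+1)], the graph of [dot (vec i) p + s i]; [G p b]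
    counts those through the point [(p, b)]. *)
Let G p (b : F) : nat := #|[set i in A | dot (vec i) p + s i == b]|.

Let sum_G p : (\sum_b G p b = #|A|)%N.
Proof.
rewrite -sum1_card (partition_big (fun i => dot (vec i) p + s i) xpredT) //=.
by apply: eq_bigr => b _; rewrite /G -sum1_card; apply: eq_bigl => i; rewrite inE.
Qed.

(** Counting common points of pairs of hyperplanes: at most [q^m] on the diagonal and, [vec] being
    injective, at most [q^(m-1)] off it. *)
Let sum_G2 : (#|F| * \sum_p \sum_b G p b ^ 2 <=
  #|A| * #|F| ^ m.+1 + #|A| ^ 2 * #|F| ^ m)%N.
Proof.
have GE p b : (G p b = \sum_(i in A) ((dot (vec i) p + s i)%R == b))%N.
  rewrite /G -sum1_card (eq_bigl (fun i => (i \in A) && (dot (vec i) p + s i == b))).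
    by rewrite big_mkcondr; apply: eq_bigr => i _; case: eqP.
  by move=> i; rewrite inE.
have -> : (\sum_p \sum_b G p b ^ 2 = \sum_(i in A) \sum_(j in A)
    #|[set p | (dot (vec i) p + s i)%R == (dot (vec j) p + s j)%R]|)%N.
  transitivity (\sum_p \sum_(i in A) \sum_(j in A)
      ((dot (vec i) p + s i)%R == (dot (vec j) p + s j)%R : nat))%N.
    apply: eq_bigr => p _; under eq_bigr => b _ do
      rewrite GE -mulnn big_distrlr /=.
    rewrite exchange_big /=; apply: eq_bigr => i _.
    rewrite exchange_big /=; apply: eq_bigr => j _.
    rewrite (bigD1 (dot (vec j) p + s j)) //= eqxx muln1 big1 ?addn0 //.
    by move=> b bj; rewrite [dot (vec j) p + s j == b]eq_sym (negPf bj) muln0.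
  rewrite exchange_big /=; apply: eq_bigr => i _.
  rewrite exchange_big /=; apply: eq_bigr => j _.
  rewrite -sum1_card big_mkcond [RHS]big_mkcond /=; apply: eq_bigr => p _.
  by rewrite inE; case: eqP.
rewrite big_distrr /=.
have -> : (#|A| * #|F| ^ m.+1 + #|A| ^ 2 * #|F| ^ m =
    \sum_(i in A) (#|F| ^ m.+1 + #|A| * #|F| ^ m))%N.
  by rewrite sum_nat_const mulnDr mulnA.
apply: leq_sum => i Ai; rewrite big_distrr /= (bigD1 i) //=; apply: leq_add.
  rewrite expnS leq_mul2l; apply/orP; right.
  by rewrite (leq_trans (max_card _)) // card_mx mul1n.
apply: (@leq_trans (\sum_(j in A | j != i) #|F| ^ m)).
  apply: leq_sum => j /andP[_ ji].
  have vij : vec i - vec j != 0.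
    by rewrite subr_eq0; apply: contra ji => /eqP/vec_inj ->.
  rewrite -(card_hyperplane (s j - s i) vij) leq_mul2l; apply/orP; right.
  apply: subset_leq_card; apply/fintype.subsetP => p; rewrite !inE dotBl => /eqP e.
  by apply/eqP; rewrite -[dot (vec i) p](addrK (s i)) e; ring.
rewrite sum_nat_const leq_mul2r; apply/orP; right; apply: subset_leq_card.
by apply/fintype.subsetP => j; rewrite unfold_in => /andP[].
Qed.

(** The mean of [G] is [|A|/q], and [sum_G2] bounds the sum of all [(q G - |A|)^2] by [|A| q^(m+2)].
    Cauchy-Schwarz over the distinct points of [B] bounds the squared deviation of [q N] from
    [|A| |B|] by [|A| |B| q^(m+2)], hence by [(|A| |B|)^2]. *)
Lemma incidence_bound : (#|F| ^ m.+2 <= #|A| * #|B|)%N ->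
  (#|F| * \sum_(j in B) G (pt j) (r j) <= 2 * (#|A| * #|B|))%N.
Proof.
move=> large; set N := (\sum_(j in B) _)%N.
pose q : rat := #|F|%:R; pose a : rat := #|A|%:R; pose b : rat := #|B|%:R.
pose x p c : rat := q * (G p c)%:R - a.
have q0 : 0 <= q by apply: ler0n.
have sumx : \sum_(j in B) x (pt j) (r j) = q * N%:R - a * b.
  by rewrite /x sumrB -mulr_sumr -natr_sum sumr_const -[_ *+ #|B|]mulr_natr.
have le_all : \sum_(j in B) x (pt j) (r j) ^+ 2 <= \sum_p \sum_c x p c ^+ 2.
  apply: (@le_trans _ _ (\sum_(j in B) \sum_c x (pt j) c ^+ 2)).
    apply: ler_sum => j _; rewrite (bigD1 (r j)) //= lerDl.
    by apply: sumr_ge0 => c _; apply: sqr_ge0.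
  rewrite -(big_imset (fun p => \sum_c x p c ^+ 2)) /=; last by move=> j k _ _ /pt_inj.
  rewrite big_mkcond; apply: ler_sum => p _; case: ifP => // _.
  by apply: sumr_ge0 => c _; apply: sqr_ge0.
pose S : rat := (\sum_p \sum_c G p c ^ 2)%:R.
have total : \sum_p \sum_c x p c ^+ 2 = q ^+ 2 * S - a ^+ 2 * q ^+ m.+1.
  transitivity (\sum_p (q ^+ 2 * (\sum_c G p c ^ 2)%:R - q * a ^+ 2)).
    apply: eq_bigr => p _.
    transitivity (\sum_c (q ^+ 2 * (G p c ^ 2)%:R - 2 * q * a * (G p c)%:R + a ^+ 2)).
      by apply: eq_bigr => c _; rewrite /x natrX; ring.
    rewrite big_split sumrB -!mulr_sumr -!natr_sum sum_G /= sumr_const.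
    by rewrite -[_ *+ #|F|]mulr_natl -/q -/a; ring.
  rewrite sumrB -mulr_sumr -natr_sum sumr_const card_mx mul1n.
  by rewrite -[_ *+ (_ ^ _)]mulr_natl natrX -/q -/S [q ^+ m.+1]exprS; ring.
have leS : q * S <= a * q ^+ m.+1 + a ^+ 2 * q ^+ m.
  by rewrite /q /a -!natrX -!natrM -natrD ler_nat sum_G2.
have large' : q ^+ m.+2 <= a * b by rewrite /q /a -natrX -natrM ler_nat.
have ab0 : 0 <= a * b by rewrite mulr_ge0 ?ler0n.
have : (q * N%:R - a * b) ^+ 2 <= (a * b) ^+ 2.
  rewrite -sumx; apply: le_trans (sqr_sum_le _ _) _.
  apply: (@le_trans _ _ (b * (q * (a * q ^+ m.+1)))).
    rewrite ler_wpM2l ?ler0n // (le_trans le_all) // total.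
    have := ler_wpM2l q0 leS; rewrite !exprS; lra.
  have -> : b * (q * (a * q ^+ m.+1)) = a * b * q ^+ m.+2 by rewrite !exprS; ring.
  by rewrite expr2 ler_wpM2l.
move=> le_sqr; have : q * N%:R - a * b <= a * b.
  rewrite leNgt; apply/negP => lt; move: le_sqr; rewrite leNgt => /negP; apply.
  by rewrite !expr2; apply: ltr_pM.
rewrite -(ler_nat rat) !natrM -/q -/a -/b; lra.
Qed.

End Incidence.

Section Distances.

Variables (F : finFieldType) (d : nat).
Hypothesis oddF : odd #|F|.
Variable E : {set 'rV[F]_d}.

Lemma odd_card_two_neq0 : (2%:R : F) != 0.
Proof.
apply/negP => /eqP two0; have char2 : 2 \in [pchar F] by rewrite !inE two0 eqxx.
have cardF : #|F| = (2 ^ logn 2 #|F|)%N := card_pprimeChar char2.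
move: oddF (finNzRing_gt1 F); rewrite cardF oddX orbF => /eqP ->.
by rewrite expn0.
Qed.

Lemma sqnormB (x y : 'rV[F]_d) :
  sqnorm (x - y) = sqnorm x - 2%:R * dot y x + sqnorm y.
Proof.
rewrite /sqnorm /dot mulr_sumr -sumrB -big_split; apply: eq_bigr => i _ /=.
by rewrite !mxE; ring.
Qed.

(** Expanding squares makes equality of two distances linear in the lifted data [vec], [pt], [s],
    [r], where [vec] is injective because 2 is invertible. With [N] the number of incidences,
    [|P|^2 <= |Delta| N] and [q N <= 2 |P|^2]. *)
Lemma card_distance_set : (#|F| ^ d.+1 <= #|E| ^ 2)%N ->
  (#|F| <= 2 * #|distance_set E|)%N.
Proof.
move=> large; pose T := ('rV[F]_d * 'rV[F]_d)%type; pose P : {set T} := finset.setX E E.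
have cardP : #|P| = (#|E| ^ 2)%N by rewrite cardsX mulnn.
pose vec (w : T) := row_mx (2%:R *: w.1) (- (2%:R *: w.2)).
pose pt (w : T) := row_mx w.1 w.2.
pose s (w : T) := sqnorm w.2 - sqnorm w.1.
pose r (w : T) := sqnorm w.1 - sqnorm w.2.
pose dist (w : T) := sqnorm (w.1 - w.2).
have vec_inj : injective vec.
  move=> [x y] [x' y'] /eq_row_mx /= [ex /oppr_inj ey].
  by rewrite (scalerI odd_card_two_neq0 ex) (scalerI odd_card_two_neq0 ey).
have pt_inj : injective pt by move=> [x y] [x' y'] /eq_row_mx /= [-> ->].
have incE (w u : T) : (dot (vec w) (pt u) + s w == r u) =
    (dist (u.1, w.1) == dist (u.2, w.2)).
  rewrite -subr_eq0 -[RHS]subr_eq0 -[RHS]oppr_eq0; congr (_ == 0).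
  have -> : dot (vec w) (pt u) = 2%:R * dot w.1 u.1 - 2%:R * dot w.2 u.2.
    rewrite /dot big_split_ord /= !mulr_sumr -sumrN; congr (_ + _).
      by apply: eq_bigr => i _; rewrite !row_mxEl mxE mulrA.
    by apply: eq_bigr => i _; rewrite !row_mxEr !mxE mulNr mulrA.
  by rewrite /dist !sqnormB /s /r; ring.
pose nu t := #|[set w in P | dist w == t]|.
have nuE t : nu t = (\sum_(w in P) (dist w == t))%N.
  rewrite /nu -sum1_card (eq_bigl (fun w => (w \in P) && (dist w == t))).
    by rewrite big_mkcondr; apply: eq_bigr => w _; case: eqP.
  by move=> w; rewrite inE.
have sum_nu : (\sum_(t in distance_set E) nu t = #|P|)%N.
  rewrite -sum1_card (partition_big dist (mem (distance_set E))) /=.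
    by apply: eq_bigr => t _; rewrite /nu -sum1_card; apply: eq_bigl => w; rewrite inE.
  by move=> [x y]; rewrite inE => /andP[/= Ex Ey]; apply/imset2P; exists x y.
have large2 : (#|F| ^ (d + d).+2 <= #|P| * #|P|)%N.
  have -> : (d + d).+2 = (d.+1 + d.+1)%N by rewrite addSn addnS.
  by rewrite cardP expnD; apply: leq_mul.
have := @incidence_bound F (d + d) _ _ P P vec pt s r vec_inj pt_inj large2.
set N := (\sum_(j in P) _)%N => leN.
have NE : N = (\sum_(u in P) \sum_(w in P) (dist u == dist w))%N.
  transitivity (\sum_(u in P) \sum_(w in P) (dist (u.1, w.1) == dist (u.2, w.2)))%N.
    apply: eq_bigr => u _.
    rewrite -sum1_card (eq_bigl (fun w => (w \in P) &&
      (dist (u.1, w.1) == dist (u.2, w.2)))).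
      by rewrite big_mkcondr; apply: eq_bigr => w _; case: eqP.
    by move=> w; rewrite inE incE.
  rewrite !pair_big /=.
  (* Regrouping [((x, x'), (y, y'))] as [((x, y), (x', y'))] turns incidences into pairs of equal
     distances. *)
  pose h (z : T * T) : T * T := ((z.1.1, z.2.1), (z.1.2, z.2.2)).
  have hK : involutive h by move=> [[? ?] [? ?]].
  rewrite (reindex_inj (inv_inj hK)) /=; apply: eq_bigl => -[[x y] [x' y']] /=.
  by rewrite !inE /=; case: (x \in E); case: (y \in E); case: (x' \in E).
have sum_nu2 : (\sum_(t in distance_set E) nu t ^ 2 <= N)%N.
  apply: (@leq_trans (\sum_t nu t ^ 2)).
    by rewrite big_mkcond; apply: leq_sum => t _; case: ifP.
  under eq_bigr => t _ do rewrite nuE -mulnn big_distrlr /=.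
  rewrite NE exchange_big /=; apply: leq_sum => u _.
  rewrite exchange_big /=; apply: leq_sum => w _.
  rewrite (bigD1 (dist w)) //= eqxx muln1 big1 ?addn0 //.
  by move=> t tw; rewrite [dist w == t]eq_sym (negPf tw) muln0.
have cs : (#|P| ^ 2 <= #|distance_set E| * N)%N.
  apply: leq_trans (leq_mul (leqnn _) sum_nu2).
  rewrite -sum_nu -(ler_nat rat) natrM natrX !natr_sum.
  under [X in _ <= _ * X]eq_bigr => t _ do rewrite natrX.
  exact: sqr_sum_le.
have P0 : (0 < #|P|)%N.
  by rewrite cardP (leq_trans _ large) // expn_gt0 (ltn_trans _ (finNzRing_gt1 F)).
rewrite -(leq_pmul2r (_ : 0 < #|P| ^ 2)%N) ?expn_gt0 ?P0 //.
apply: (@leq_trans (#|F| * (#|distance_set E| * N))).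
  by rewrite leq_mul2l cs orbT.
rewrite mulnCA -mulnn [(2 * _)%N]mulnC -[X in (_ <= X)%N]mulnA.
by rewrite leq_mul2l leN orbT.
Qed.

End Distances.

(** * Comparison of the thresholds *)

Section Thresholds.

Variables (R : realFieldType) (d n g : nat) (ell alpha : R).
Hypotheses (n1 : (1 <= n)%N) (ng : (n <= g)%N) (ell0 : 0 <= ell).

Let G : R := g%:R.
Let d' : R := d%:R.
Let nG : n%:R <= G. Proof. by rewrite ler_nat. Qed.
Let G1 : 1 <= G. Proof. by rewrite (ler_nat R 1) (leq_trans n1). Qed.

(** Dropping the term in [ell] leaves [(d+2) G / (2G+1)]. This is at least [(d+1)/2] if [2G >= d+1],
    and at least [G + G/(2G+1) >= n + 1/4] if [d >= 2G]. *)
Lemma first_threshold :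
  (d%:R + 2 + G^-1 * ell) / (2 + G^-1) <= alpha ->
  (d%:R + 1) / 2 <= alpha \/ (n <= d)%N /\ n%:R + 4^-1 <= alpha.
Proof.
move=> thr; have G0 : 0 < G := lt_le_trans ltr01 G1.
have le : (d' + 2) * G <= (2 * G + 1) * alpha.
  have den : 0 < 2 + G^-1 by rewrite addr_gt0 // invr_gt0.
  move: thr; rewrite ler_pdivrMr // => /(ler_wpM2l (ltW G0)).
  have -> : G * (d%:R + 2 + G^-1 * ell) = (d' + 2) * G + ell.
    by rewrite /d'; field; rewrite gt_eqF.
  have -> : G * (alpha * (2 + G^-1)) = (2 * G + 1) * alpha.
    by field; rewrite gt_eqF.
  by apply: le_trans; rewrite lerDl.
have [gd|dg] := leqP (2 * g) d; [right|left].
  split; first lia.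
  have : 2 * G <= d' by rewrite -natrM ler_nat.
  move: nG G1 le => ? ? ? Gd; nra.
have : d' + 1 <= 2 * G by rewrite /d' /G natr1 -natrM ler_nat.
rewrite -/d'; move: nG G1 le => ? ? ? Gd; nra.
Qed.

(** Likewise [(d+4) G / (2G+2)] is at least [(d+1)/2] if [3G >= d+1], and at least [3G/2] if
    [3G <= d+1]. *)
Lemma second_threshold :
  (d%:R + 4 + 2 * G^-1 * ell) / (2 + 2 * G^-1) <= alpha ->
  (d%:R + 1) / 2 <= alpha \/ (n <= d)%N /\ n%:R + 4^-1 <= alpha.
Proof.
move=> thr; have G0 : 0 < G := lt_le_trans ltr01 G1.
have le : (d' + 4) * G <= (2 * G + 2) * alpha.
  have den : 0 < 2 + 2 * G^-1 by rewrite addr_gt0 // mulr_gt0 // invr_gt0.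
  move: thr; rewrite ler_pdivrMr // => /(ler_wpM2l (ltW G0)).
  have -> : G * (d%:R + 4 + 2 * G^-1 * ell) = (d' + 4) * G + 2 * ell.
    by rewrite /d'; field; rewrite gt_eqF.
  have -> : G * (alpha * (2 + 2 * G^-1)) = (2 * G + 2) * alpha.
    by field; rewrite gt_eqF.
  by apply: le_trans; rewrite lerDl mulr_ge0.
have [gd|dg] := leqP (3 * g) d.+1; [right|left].
  split; first lia.
  have : 3 * G <= d' + 1 by rewrite /d' /G natr1 -natrM ler_nat.
  move: nG G1 le => ? ? ? Gd; nra.
have : d' + 2 <= 3 * G by rewrite /d' /G -natrM -natrD ler_nat; lia.
rewrite -/d'; move: nG G1 le => ? ? ? Gd; nra.
Qed.

End Thresholds.

Lemma gammaE (R : realType) (n : nat) :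
  gamma R n = (2 ^ n.+1 - n - 2)%N%:R^-1.
Proof.
have le n' : (n' + 2 <= 2 ^ n'.+1)%N.
  by elim: n' => // k IHk; rewrite expnS; lia.
by rewrite /gamma -subnDA natrB ?le // natrD natrX -addrA -opprD.
Qed.

Lemma exponent_ge (n : nat) : (1 <= n)%N -> (n <= 2 ^ n.+1 - n - 2)%N.
Proof.
move=> n1; suff : (2 * n + 2 <= 2 ^ n.+1)%N by lia.
by elim: n n1 => // -[|k] // IHk _; rewrite expnS; move: (IHk isT); lia.
Qed.

Theorem corollary9 (R : realType) (d n D : nat)
    (hd : (2 <= d)%N) (hn : (1 <= n)%N) :
  exists2 c : R, 0 < c &
  exists q0 : nat,
  forall (F : finFieldType) (K : closedFieldType) (iota : {rmorphism F -> K}),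
    integralRange iota ->
    odd #|F| -> (q0 <= #|F|)%N ->
  forall V : set 'rV[K]_d,
    irreducible_variety iota V -> is_dim iota V n -> is_degree V n D ->
  forall (ell alpha : R) (E : {set 'rV[F]_d}),
    (coset_content iota V)%:R = #|F|%:R `^ ell ->
    E \subset rational_points iota V ->
    #|E|%:R = #|F|%:R `^ alpha ->
    Num.min
      ((d%:R + 2 + gamma R n * ell) / (2 + gamma R n))
      ((d%:R + 4 + 2 * gamma R n * ell) / (2 + 2 * gamma R n)) <= alpha ->
    c * #|F|%:R <= #|distance_set E|%:R.
Proof.
exists 2^-1; first by rewrite invr_gt0.
(* The first summand serves [card_rational_points]; the second contradicts [q^(1/4) <= D]. *)
exists (D.+1 * d + D ^ 4).+1 => F K iota iota_int oddF largeF V.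
move=> [vV _ _] [_ dimV] [degV _] ell alpha E tE EV cardE thr.
set q : R := #|F|%:R in tE cardE *.
have q1 : 1 < q by rewrite (ltr_nat R 1) finfield.finNzRing_gt1.
have q0 : 0 < q by apply: lt_trans q1.
(* The coset content is a natural number and, as a power of [q], positive; so it is at least 1. *)
have ell0 : 0 <= ell.
  rewrite leNgt; apply/negP => ell_lt0.
  have : ln (coset_content iota V)%:R < 0 :> R.
    by rewrite tE ln_powR nmulr_rlt0 // ln_gt0.
  apply/negP; rewrite -leNgt ln_ge0 // (ler_nat R 1) -(ltr_nat R) tE.
  exact: powR_gt0.
have [big|[nd big]] : (d%:R + 1) / 2 <= alpha \/ (n <= d)%N /\ n%:R + 4^-1 <= alpha.
  move: thr; rewrite ge_min gammaE => /orP[].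
    exact: (first_threshold hn (exponent_ge hn) ell0).
  exact: (second_threshold hn (exponent_ge hn) ell0).
- have large : (#|F| ^ d.+1 <= #|E| ^ 2)%N.
    rewrite -(ler_nat R) !natrX cardE -/q -!powR_mulrn ?powR_ge0 ?(ltW q0) //.
    by rewrite -powRrM ler_powR ?(ltW q1) // -natr1; lra.
  have := card_distance_set oddF large; rewrite -(ler_nat R) natrM -/q; lra.
- have := @card_rational_points F K iota d n D V.
  have largeF' : (D.+1 * d < #|F|)%N by apply: leq_trans largeF; rewrite ltnS leq_addr.
  move=> /(_ (variety_zclosed vV) degV largeF' nd).
  move=> /(_ (zdim_le_variety iota_int vV dimV)) /(leq_trans (subset_leq_card EV)).
  rewrite -(ler_nat R) natrM natrX -/q cardE => leV.
  have : q `^ n%:R * q `^ 4^-1 <= D%:R * q `^ n%:R.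
    rewrite -powRD ?(gt_eqF q0) ?implybT // powR_mulrn ?(ltW q0) //.
    by apply: le_trans leV; apply: ler_powR; rewrite ?(ltW q1).
  rewrite mulrC ler_pM2r ?powR_gt0 // => leD.
  have : q <= D%:R ^+ 4.
    have -> : q = (q `^ 4^-1) ^+ 4.
      by rewrite -powR_mulrn ?powR_ge0 // -powRrM mulVf ?pnatr_eq0 ?powRr1 ?(ltW q0).
    by apply: lerXn2r; rewrite // nnegrE ?powR_ge0.
  rewrite -natrX ler_nat => leF; move: largeF; rewrite ltnNge => /negP[].
  exact: leq_trans leF (leq_addl _ _).
Qed.
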